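(* Let $X=(X_{t})_{t\in T}$ be a separable Gaussian process indexed by a semimetric space $T$ such that $\mathrm{E}[X_t]=0$ and $\mathrm{E}[X_t^2]=1$ for all $t\in T$. Assume that $\sup_{t\in T}X_t<\infty$ almost surely. Then $a(X):=\mathrm{E}[\sup_{t\in T}X_t]\in[0,\infty)$ and, for all $\epsilon\ge 0$, $$\sup_{x\in\mathbb{R}}\mathrm{P}\Bigl(\Bigl|\sup_{t\in T}X_t-x\Bigr|\le\epsilon\Bigr)\le 4\epsilon\,(a(X)+1).$$
   Context: The process is defined on a complete probability space $(\Omega,\mathcal{A},\mathrm{P})$, and $T$ is nonempty. Separable means: there are a countable subset $T_0\subset T$ and a null set $N$ such that for every $\omega\notin N$ and every $t\in T$ there is a sequence $s_m\in T_0$ with $s_m\to t$ and $X_{s_m}(\omega)\to X_t(\omega)$. *)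

(* Defs.v *)
From HB Require Import structures.
From mathcomp Require Import all_boot all_order all_algebra.
From mathcomp Require Import all_classical all_reals all_analysis.

Set Implicit Arguments.
Unset Strict Implicit.
Unset Printing Implicit Defensive.

Import Order.TTheory GRing.Theory Num.Theory.
Import numFieldNormedType.Exports.

Local Open Scope classical_set_scope.
Local Open Scope ring_scope.
Local Open Scope ereal_scope.

(* The normal law N(m, s^2).  The case s = 0 is the point mass at m; it has to
   be singled out because the library's [normal_prob m 0] is, by convention,
   the uniform law on [0, 1]. *)
Definition normal_law {R : realType} (m s : R) (A : set R) : \bar R :=
  if s == 0%R then \d_m A else normal_prob m s A.

Section gaussian_process.
Context {R : realType} {d : measure_display} {Omega : measurableType d}.
Variable P : probability Omega R.

Definition normal_rv (Y : Omega -> R) : Prop :=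
  measurable_fun [set: Omega] Y /\
  exists m s : R, forall A : set R, measurable A ->
    P (Y @^-1` A) = normal_law m s A.

(* A random vector is multivariate normal (possibly degenerate) when all
   linear combinations of its coordinates are normal. *)
Definition multivariate_normal (n : nat) (Y : 'I_n -> Omega -> R) : Prop :=
  forall a : 'I_n -> R, normal_rv (fun w => (\sum_(i < n) a i * Y i w)%R).

Definition is_gaussian_process {T : Type} (X : T -> {RV P >-> R}) : Prop :=
  forall (n : nat) (t : 'I_n -> T), multivariate_normal (fun i => X (t i)).

Definition is_separable_process {T : pseudoMetricType R}
    (X : T -> {RV P >-> R}) : Prop :=
  exists (T0 : set T) (N : set Omega),
    [/\ countable T0, P.-negligible N &
        forall w, ~ N w -> forall t : T, exists s : nat -> T,
          [/\ forall k, T0 (s k),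
              s @ \oo --> t &
              (fun k => X (s k) w) @ \oo --> X t w]].

(* The supremum is taken in the extended reals, so it is meaningful even on
   the null event where it is infinite. *)
Definition process_sup {T : Type} (X : T -> {RV P >-> R}) (w : Omega) : \bar R :=
  ereal_sup [set (X t w)%:E | t in [set: T]].

End gaussian_process.

(* Main.v *)
(** Writing [M] for the supremum, [M] equals almost surely the supremum of a
    sequence [X_0, X_1, ...], and it is enough to bound [P (u < M_n <= v)] by
    [2 (v - u) E[M^+]] for the partial maxima [M_n], because
    [E[M^+] <= a + E[(1 + X_0 ^ 2) / 2] = a + 1].

    For the bound, let [rho_ij = E[X_i X_j]].  The residuals
    [X_i - rho_ij X_j] are independent of [X_j], and [j] is the first argmax of
    [M_n] with [X_j = y] exactly when they lie in a rectangle that grows with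
    [y], as [rho_ij <= 1].  With [G y] the sum over [j] of the probabilities of
    these rectangles, decomposing over the argmax gives
    [P (u < M_n <= v) <= N(0,1) ]u, v] * G v] and, from
    [E[Z; Z > y] = phi y] for a standard normal [Z], also
    [phi y * G y <= E[M^+]] for [y >= 0].  On a short interval the density
    [phi] varies by a factor at most [2] above [0], and longer intervals are
    subdivided.

    Integrability of [M] is Fernique's argument: rotation invariance of a pair
    of independent copies of the process turns a quantile of [sup |X_k|] into
    a tail that decays fast enough.  Independence and rotation invariance both
    rest on the fact that the integrals of all functions [cos (<a, Y> + c)],
    possibly against a bounded signed weight, determine the law of [Y]. *)

(* A Gaussian process only promises that each linear combination is normal with some unknown
   parameters. These are identified from the first two moments; joint laws are then handled through
   the values of [E cos (L + c)], a form that is stable under linear changes of coordinates and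
   covers degenerate covariances.

   A first argmax need not exist for a whole sequence, so the decomposition is made for partial
   maxima, with bounds uniform in [n] that pass to the supremum along increasing events. Its two
   halves live at different levels: the density is taken at the left end of an interval and [G] at
   the right end. Reconciling them costs a factor 2; the other factor 2 in the constant 4 is the
   length [2 eps] of the interval. Levels are cut off at 0, since below it neither the monotonicity
   of the density nor the sign of the test function [x 1(x > y)] is available; being nonnegative,
   that test function leads to [E[M^+]] instead of [E[M]]. *)
Require Import Defs.
From HB Require Import structures.
From mathcomp Require Import all_boot all_order all_algebra.
From mathcomp Require Import all_classical all_reals all_analysis.
From mathcomp Require Import measurable_realfun ring lra.

Set Implicit Arguments.
Unset Strict Implicit.
Unset Printing Implicit Defensive.

Import Order.TTheory GRing.Theory Num.Theory.
Import numFieldNormedType.Exports.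

Local Open Scope classical_set_scope.
Local Open Scope ring_scope.
Local Open Scope ereal_scope.

(** * The normal law *)

Section normal_integrals.
Context {R : realType}.
Local Notation lambda := (@lebesgue_measure R).
Implicit Types m s : R.

Lemma ae_eq_density_normal m s :
  ae_eq lambda setT (Radon_Nikodym_SigmaFinite.f (normal_prob m s) lambda)
        (EFin \o normal_pdf m s).
Proof.
apply: integral_ae_eq => //.
- exact: Radon_Nikodym_SigmaFinite.f_integrable (normal_prob_dominates m s).
- by apply/measurable_EFinP; exact: measurable_normal_pdf.
- move=> E _ mE.
  by rewrite -Radon_Nikodym_SigmaFinite.f_integral//; exact: normal_prob_dominates.
Qed.

Lemma ge0_integral_normal_prob m s (f : R -> \bar R) :
  measurable_fun setT f -> (forall x, 0 <= f x) ->
  \int[normal_prob m s]_x f x = \int[lambda]_x (f x * (normal_pdf m s x)%:E).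
Proof.
move=> mf f0.
rewrite -(Radon_Nikodym_SigmaFinite.change_of_variables (normal_prob_dominates m s))//.
apply: ae_eq_integral => //.
- apply: emeasurable_funM => //.
  exact: measurable_int (Radon_Nikodym_SigmaFinite.f_integrable (normal_prob_dominates m s)).
- by apply: emeasurable_funM => //; apply/measurable_EFinP; exact: measurable_normal_pdf.
- apply: ae_eqe_mul2l; exact: ae_eq_density_normal.
Qed.

Lemma bounded_integrable d (T : measurableType d) (P : probability T R)
    (f : T -> R) (C : R) :
  measurable_fun setT f -> (forall x, (`|f x| <= C)%R) ->
  P.-integrable setT (EFin \o f).
Proof.
move=> mf fC; apply: measurable_bounded_integrable => //.
  rewrite [X in X < _](_ : _ = 1) ?ltry//; exact: probability_setT.
exists C; split; first exact: num_real.
by move=> M CM x _; exact: le_trans (fC x) (ltW CM).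
Qed.

Lemma integral_normal_prob m s (f : R -> \bar R) :
  (normal_prob m s).-integrable setT f ->
  \int[normal_prob m s]_x f x = \int[lambda]_x (f x * (normal_pdf m s x)%:E).
Proof.
move=> intf.
rewrite -(Radon_Nikodym_change_of_variables (normal_prob_dominates m s))//.
have mf := measurable_int _ intf.
apply: ae_eq_integral => //.
- apply: (emeasurable_funM mf).
  apply: (measurable_int lambda); apply: Radon_Nikodym_integrable.
  exact: normal_prob_dominates.
- by apply: emeasurable_funM => //; apply/measurable_EFinP; exact: measurable_normal_pdf.
- apply: ae_eqe_mul2l.
  apply: (ae_eq_trans (ae_eq_sym _) (ae_eq_density_normal m s)).
  apply: ae_eq_Radon_Nikodym_SigmaFinite => //.
  exact: normal_prob_dominates.
Qed.

(** Completing the square: an exponential tilt moves the mean by [s ^+ 2 * b] and keeps the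
    variance. Besides the moment generating function, it provides the integrable majorant of [|x|]
    times the density. *)
Lemma normal_pdf_tilt m s b x : s != 0%R ->
  (expR (b * x) * normal_pdf m s x =
   expR (m * b + s ^+ 2 * b ^+ 2 / 2) * normal_pdf (m + s ^+ 2 * b) s x)%R.
Proof.
move=> s0; rewrite !normal_pdfE// !mulrA ![(expR _ * _)%R]mulrC -!mulrA.
congr *%R; rewrite /normal_fun -!expRD; congr expR.
by field.
Qed.

Lemma normal_mgf m s b : s != 0%R ->
  \int[normal_prob m s]_x (expR (b * x))%:E =
  (expR (m * b + s ^+ 2 * b ^+ 2 / 2))%:E.
Proof.
move=> s0; rewrite ge0_integral_normal_prob//; last first.
  by apply/measurable_EFinP/measurableT_comp => //; exact: measurable_funM.
under eq_integral do rewrite -EFinM normal_pdf_tilt// EFinM.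
rewrite ge0_integralZl//=.
- by rewrite integral_normal_pdf mule1.
- by apply/measurable_EFinP; exact: measurable_normal_pdf.
- by move=> x _; rewrite lee_fin normal_pdf_ge0.
Qed.

End normal_integrals.

(** * Characteristic function of the normal law, with a phase *)

Section normal_characteristic.
Context {R : realType}.
Local Notation lambda := (@lebesgue_measure R).

Lemma is_derive_continuous (f : R -> R) (df : R -> R) :
  (forall x : R, is_derive (x : R) (1 : R)%R f (df x)) -> continuous f.
Proof.
move=> H x; apply: differentiable_continuous; apply/derivable1_diffP.
by case: (H x).
Qed.

Lemma is_derive_cos_affine (t c x : R) :
  is_derive (x : R) (1 : R)%R (fun u => cos (t * u + c)) (- t * sin (t * x + c))%R.
Proof.
apply: (@is_derive_eq _ _ _ _ _ _ _ _ (@is_derive1_comp R cos (fun u => t * u + c)%R x _ _ _ _)).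
by rewrite /= /GRing.scale/=; ring.
Qed.

Lemma is_derive_sin_affine (t c x : R) :
  is_derive (x : R) (1 : R)%R (fun u => sin (t * u + c)) (t * cos (t * x + c))%R.
Proof.
apply: (@is_derive_eq _ _ _ _ _ _ _ _ (@is_derive1_comp R sin (fun u => t * u + c)%R x _ _ _ _)).
by rewrite /= /GRing.scale/=; ring.
Qed.

Lemma is_derive_normal_pdf (s x : R) : s != 0%R ->
  is_derive (x : R) (1 : R)%R (normal_pdf 0 s) (- (x / s ^+ 2) * normal_pdf 0 s x)%R.
Proof.
move=> s0; rewrite normal_pdfE// /normal_fun.
apply: is_derive_eq.
by rewrite /= /GRing.scale/=; field.
Qed.

(** The fundamental theorem of calculus on growing symmetric intervals leaves only boundary terms,
    which vanish; dominated convergence identifies the limit with the full integral. This is the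
    form in which integration by parts is used. *)
Lemma integral_derivative_eq0 (H f : R -> R) :
  (forall x : R, is_derive (x : R) (1 : R)%R H (f x)) -> continuous f ->
  lambda.-integrable setT (EFin \o f) ->
  H n%:R @[n --> \oo] --> (0 : R)%R -> H (- n%:R)%R @[n --> \oo] --> (0 : R)%R ->
  \int[lambda]_x (f x)%:E = 0.
Proof.
move=> dH cf intf H0 H0'.
(* [n.+1] keeps the endpoints strictly ordered also at [n = 0], as the fundamental theorem
   requires. *)
pose I n : set R := `[(- n.+1%:R)%R, n.+1%:R%R]%classic.
have E n : \int[lambda]_(x in I n) (f x)%:E = (H n.+1%:R - H (- n.+1%:R))%:E.
  rewrite EFinB; apply: continuous_FTC2.
  - by rewrite gtrN// ltr0n.
  - exact: continuous_subspaceT.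
  - split.
    + by move=> x _; case: (dH x).
    + by apply: cvg_at_right_filter; exact: (is_derive_continuous dH).
    + by apply: cvg_at_left_filter; exact: (is_derive_continuous dH).
  - by move=> x _; rewrite derive1E; case: (dH x).
have lim0 : \int[lambda]_(x in I n) (f x)%:E @[n --> \oo] --> 0.
  under eq_cvg do rewrite E.
  apply: cvg_EFin; first exact: nearW.
  rewrite -(subrr (0 : R)%R); apply: cvgB.
    by move: H0; rewrite -cvg_shiftS.
  by move: H0'; rewrite -cvg_shiftS.
have limI : \int[lambda]_(x in I n) (f x)%:E @[n --> \oo] --> \int[lambda]_x (f x)%:E.
  under eq_cvg do rewrite integral_mkcond.
  apply: (@dominated_cvg _ _ _ lambda _ measurableT _ _ (fun x => (`|f x|)%:E)) => //.
  - move=> n; apply/(measurable_restrictT _ _).1 => //.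
    exact: measurable_itv.
    apply/measurable_EFinP; apply: measurable_funTS.
    exact: continuous_measurable_fun.
  - move=> x _; apply: cvg_near_cst.
    near=> n; rewrite patchT// inE /I/= in_itv/= -ler_norml.
    near: n; exists (Num.truncn `|x|) => //= n /= nx.
    apply/ltW; rewrite (lt_le_trans (truncnS_gt _))// ler_nat ltnS//.
  - by have := integrable_norm intf.
  - move=> n x _; rewrite patchE; case: ifPn => // _.
    by rewrite abse0 lee_fin.
exact: cvg_unique limI lim0.
Unshelve. all: by end_near. Qed.

(** Since [|x| <= exp x + exp (- x)], the tilts with [b = 1] and [b = -1] bound the function by a
    multiple of two shifted normal densities; [K] is their common tilting factor. *)
Lemma integrable_id_normal_pdf (s : R) : s != 0%R ->
  lambda.-integrable setT (fun x => (`|x| * normal_pdf 0 s x)%:E).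
Proof.
move=> s0.
have mpdf m : measurable_fun setT (fun x => (normal_pdf m s x)%:E).
  by apply/measurable_EFinP; exact: measurable_normal_pdf.
pose K : R := expR (s ^+ 2 / 2).
apply: (@le_integrable _ _ _ lambda setT measurableT _
  (fun x => K%:E * ((normal_pdf (s ^+ 2) s x)%:E + (normal_pdf (- s ^+ 2) s x)%:E))).
- by apply/measurable_EFinP/measurable_funM; [exact: normr_measurable|exact: measurable_normal_pdf].
- move=> x _; rewrite -EFinD -EFinM lee_fin.
  rewrite ger0_norm ?mulr_ge0 ?normal_pdf_ge0//.
  rewrite ger0_norm; last by rewrite mulr_ge0 ?expR_ge0 ?addr_ge0 ?normal_pdf_ge0.
  have h1 := normal_pdf_tilt 0 1 x s0.
  have h2 := normal_pdf_tilt 0 (-1) x s0.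
  rewrite /K mulrDr.
  have -> : (expR (s ^+ 2 / 2) * normal_pdf (s ^+ 2) s x = expR (1 * x) * normal_pdf 0 s x)%R.
    by rewrite h1 mul0r !add0r expr1n !mulr1.
  have -> : (expR (s ^+ 2 / 2) * normal_pdf (- s ^+ 2) s x = expR (- 1 * x) * normal_pdf 0 s x)%R.
    by rewrite h2 mul0r !add0r sqrrN expr1n !mulr1 mulrN1.
  rewrite -mulrDl ler_wpM2r ?normal_pdf_ge0// mul1r mulN1r.
  have := expR_ge1Dx x; have := expR_ge1Dx (- x)%R.
  have := expR_ge0 x; have := expR_ge0 (- x)%R.
  by rewrite ler_norml; move=> *; lra.
- by apply: integrableZl => //; apply: integrableD => //; exact: integrable_normal_pdf.
Qed.

(** [exp v >= 1 + v] bounds [exp (- v)] by [1 / v], and [n ^ 2 >= n] turns that into a harmonic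
    bound. *)
Lemma cvg_normal_pdf (s : R) : s != 0%R ->
  normal_pdf 0 s n%:R @[n --> \oo] --> (0 : R)%R.
Proof.
move=> s0.
have s20 : (0 < s ^+ 2)%R by rewrite exprn_even_gt0.
have bnd n : (0 <= normal_pdf 0 s n.+1%:R <= normal_peak s * (s ^+ 2 * 2) * n.+1%:R^-1)%R.
  rewrite normal_pdf_ge0/= normal_pdfE// -mulrA ler_wpM2l ?normal_peak_ge0//.
  rewrite /normal_fun subr0.
  have n0 : (0 < n.+1%:R :> R)%R by rewrite ltr0n.
  have n1 : (1 <= n.+1%:R :> R)%R by rewrite ler1n.
  rewrite mulNr expRN.
  set v := (n.+1%:R ^+ 2 / (s ^+ 2 *+ 2))%R.
  have v0 : (0 < v)%R by rewrite divr_gt0 ?exprn_gt0// pmulrn_rgt0.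
  apply: (@le_trans _ _ v^-1%R).
    rewrite lef_pV2 ?posrE ?expR_gt0//.
    by have := expR_ge1Dx v; lra.
  have s22 : (0 < s ^+ 2 * 2)%R by lra.
  rewrite /v invf_div -[(s ^+ 2 *+ 2)%R]mulr_natr ler_pM2l//.
  by rewrite lef_pV2 ?posrE ?exprn_gt0// ler_eXnr.
pose u (n : nat) : R := normal_pdf 0 s n%:R.
suff: u n @[n --> \oo] --> (0 : R)%R by [].
rewrite -cvg_shiftS /u/=.
apply: (@squeeze_cvgr _ _ _ _ (fun=> 0%R) (fun n => normal_peak s * (s ^+ 2 * 2) * n.+1%:R^-1)%R).
- by near=> n; exact: bnd.
- exact: cvg_cst.
- rewrite -[X in _ --> X](mulr0 (normal_peak s * (s ^+ 2 * 2))%R).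
  by apply: cvgMr; exact: cvg_harmonic.
Unshelve. all: by end_near. Qed.

Lemma normal_pdfN (s x : R) : s != 0%R -> normal_pdf 0 s (- x)%R = normal_pdf 0 s x.
Proof. by move=> s0; rewrite !normal_pdfE// /normal_fun !subr0 sqrrN. Qed.

Lemma measurable_cos_affine (t c : R) : measurable_fun setT (fun x : R => cos (t * x + c)).
Proof.
by apply: continuous_measurable_fun; apply: is_derive_continuous => x; exact: is_derive_cos_affine.
Qed.

Lemma measurable_sin_affine (t c : R) : measurable_fun setT (fun x : R => sin (t * x + c)).
Proof.
by apply: continuous_measurable_fun; apply: is_derive_continuous => x; exact: is_derive_sin_affine.
Qed.

Lemma integrable_bounded_normal_pdf (s : R) (f : R -> R) (C : R) :
  measurable_fun setT f -> (forall x, (`|f x| <= C)%R) ->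
  lambda.-integrable setT (fun x => (f x * normal_pdf 0 s x)%:E).
Proof.
move=> mf fC.
apply: (@le_integrable _ _ _ lambda setT measurableT _ (fun x => C%:E * (normal_pdf 0 s x)%:E)) => //.
- by apply/measurable_EFinP/measurable_funM => //; exact: measurable_normal_pdf.
- move=> x _; rewrite -EFinM lee_fin !normrM ler_wpM2r//.
  by rewrite (le_trans (fC x))// ler_norm.
- by apply: integrableZl => //; exact: integrable_normal_pdf.
Qed.

Lemma Rintegral_normal_prob (s : R) (f : R -> R) (C : R) :
  measurable_fun setT f -> (forall x, (`|f x| <= C)%R) ->
  (\int[normal_prob 0 s]_x f x = \int[lambda]_x (f x * normal_pdf 0 s x))%R.
Proof.
move=> mf fC; rewrite /Rintegral integral_normal_prob//.
exact: (bounded_integrable (normal_prob 0 s) mf fC).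
Qed.

Lemma integrable_sin_normal_pdf (s t c : R) : s != 0%R ->
  lambda.-integrable setT (fun x => (x * sin (t * x + c) * normal_pdf 0 s x)%:E).
Proof.
move=> s0.
apply: (le_integrable measurableT _ _ (integrable_id_normal_pdf s0)).
  apply/measurable_EFinP/measurable_funM; last exact: measurable_normal_pdf.
  by apply: measurable_funM => //; exact: measurable_sin_affine.
move=> x _; rewrite lee_fin !normrM normr_id ler_wpM2r//.
by rewrite -[leRHS]mulr1 ler_wpM2l// sin_max.
Qed.

(* Integration by parts against the Gaussian density gives the equation
   F' = - s^2 t F for F(t) = E cos(tZ + c). *)
Lemma normal_characteristic (s t c : R) : s != 0%R ->
  (\int[normal_prob 0 s]_x cos (t * x + c) = expR (- (s ^+ 2 * t ^+ 2 / 2)) * cos c)%R.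
Proof.
move=> s0.
have s20 : (s ^+ 2 != 0)%R by rewrite expf_neq0.
pose f t' x : R := (cos (t' * x + c) * normal_pdf 0 s x)%R.
pose F t' : R := (\int[lambda]_x f t' x)%R.
have df (x a : R) : is_derive (a : R) (1 : R)%R (f ^~ x)
    (- (x * sin (a * x + c) * normal_pdf 0 s x))%R.
  rewrite /f.
  have -> : (fun t' => cos (t' * x + c) * normal_pdf 0 s x)%R =
            (normal_pdf 0 s x *: (fun t' => cos (x * t' + c)))%R.
    apply/funext => z; rewrite mulrC [(z * x)%R]mulrC.
    by [].
  have H := is_derive_cos_affine x c a.
  apply: is_derive_eq.
  by rewrite /GRing.scale/= [(a * x)%R]mulrC; ring.
(* Stein's identity: [h] is the derivative of [H], the product of a sine and the density, so its
   integral vanishes; the derivative of the density contributes the factor [- x / s ^+ 2]. *)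
have parts a : (\int[lambda]_x (x * sin (a * x + c) * normal_pdf 0 s x) = s ^+ 2 * a * F a)%R.
  pose H x : R := (sin (a * x + c) * normal_pdf 0 s x)%R.
  pose h x : R := (a * f a x - (s ^+ 2)^-1 * (x * sin (a * x + c) * normal_pdf 0 s x))%R.
  have dH (x : R) : is_derive (x : R) (1 : R)%R H (h x).
    have H1 := is_derive_sin_affine a c x.
    have H2 := is_derive_normal_pdf x s0.
    rewrite /H /h /f.
    have -> : (fun x0 => sin (a * x0 + c) * normal_pdf 0 s x0)%R =
      ((fun x0 => sin (a * x0 + c)) * normal_pdf 0 s)%R by [].
    apply: is_derive_eq.
    by rewrite /GRing.scale/=; ring.
  have intf : lambda.-integrable setT (fun x => (f a x)%:E).
    apply: (@integrable_bounded_normal_pdf _ _ 1%R) => [|x].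
      exact: measurable_cos_affine.
    exact: cos_max.
  have ints := integrable_sin_normal_pdf a c s0.
  have intf' : lambda.-integrable setT (fun x => a%:E * (f a x)%:E) by apply: integrableZl.
  have ints' : lambda.-integrable setT
     (fun x => (s ^+ 2)^-1%:E * (x * sin (a * x + c) * normal_pdf 0 s x)%:E).
    by apply: integrableZl.
  have ch : continuous h.
    have cc : continuous (fun x => cos (a * x + c)).
      by apply: is_derive_continuous => y; exact: is_derive_cos_affine.
    have cs : continuous (fun x => sin (a * x + c)).
      by apply: is_derive_continuous => y; exact: is_derive_sin_affine.
    have cp := @continuous_normal_pdf R 0%R s s0.
    move=> x; rewrite /h /f; apply: cvgB; apply: cvgM; [exact: cvg_cst| |exact: cvg_cst|].
      by apply: cvgM; [exact: cc|exact: cp].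
    apply: cvgM; last exact: cp.
    by apply: cvgM; [exact: cvg_id|exact: cs].
  have Hb x : (`|H x| <= normal_pdf 0 s x)%R.
    rewrite /H normrM [X in (_ * X)%R]ger0_norm ?normal_pdf_ge0//.
    by rewrite -[leRHS]mul1r ler_wpM2r ?normal_pdf_ge0// sin_max.
  have ih : \int[lambda]_x (h x)%:E = 0.
    apply: (integral_derivative_eq0 dH ch).
    - rewrite (_ : _ \o _ = fun x => a%:E * (f a x)%:E -
        (s ^+ 2)^-1%:E * (x * sin (a * x + c) * normal_pdf 0 s x)%:E).
        exact: integrableB.
      by apply/funext => x.
    - apply: norm_cvg0; apply: (@squeeze_cvgr _ _ _ _ (fun=> 0%R) (fun n => normal_pdf 0 s n%:R)).
      + by near=> n; rewrite normr_ge0 Hb.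
      + exact: cvg_cst.
      + exact: cvg_normal_pdf.
    - apply: norm_cvg0; apply: (@squeeze_cvgr _ _ _ _ (fun=> 0%R) (fun n => normal_pdf 0 s n%:R)).
      + by near=> n; rewrite normr_ge0/= -normal_pdfN// Hb.
      + exact: cvg_cst.
      + exact: cvg_normal_pdf.
  have : (\int[lambda]_x h x = 0)%R by rewrite /Rintegral ih.
  rewrite RintegralB//= RintegralZl// RintegralZl// -/(F a) => /eqP.
  rewrite subr_eq0 => /eqP e.
  by rewrite -mulrA e mulrA divff// mul1r.
(* Differentiation under the integral on a neighbourhood of [a]; [|y|] times the density dominates
   the derivative there, uniformly in the parameter. *)
have dF (a : R) : is_derive (a : R) (1 : R)%R F (- (s ^+ 2 * a * F a))%R.
  have hI : (`](a - 1)%R, (a + 1)%R[%classic : set R) a by rewrite /= in_itv/=; apply/andP; split; lra.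
  have int_f x : (`](a - 1)%R, (a + 1)%R[%classic : set R) x -> lambda.-integrable setT (EFin \o f x).
    move=> _; apply: (@integrable_bounded_normal_pdf _ _ 1%R) => [|y].
      exact: measurable_cos_affine.
    exact: cos_max.
  have der x y : (`](a - 1)%R, (a + 1)%R[%classic : set R) x -> setT y -> derivable (f ^~ y) x 1.
    by move=> _ _; case: (df y x).
  have G0 y : (0 <= `|y| * normal_pdf 0 s y)%R by rewrite mulr_ge0 ?normal_pdf_ge0.
  have ub x y : (`](a - 1)%R, (a + 1)%R[%classic : set R) x -> setT y ->
      (`|partial1of2 f x y| <= `|y| * normal_pdf 0 s y)%R.
    move=> _ _; rewrite partial1of2E; case: (df y x) => _ ->.
    rewrite normrN !normrM [X in (_ * X)%R]ger0_norm ?normal_pdf_ge0//.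
    rewrite ler_wpM2r ?normal_pdf_ge0//.
    by rewrite -[leRHS]mulr1 ler_wpM2l// sin_max.
  have D := differentiation_under_integral measurableT hI int_f der G0
    (integrable_id_normal_pdf s0) ub.
  have D' := derivable_under_integral measurableT hI int_f der G0
    (integrable_id_normal_pdf s0) ub.
  apply: DeriveDef; first exact: D'.
  rewrite -derive1E D -parts.
  have -> : (fun y => partial1of2 f a y) = fun y => (- (y * sin (a * y + c) * normal_pdf 0 s y))%R.
    by apply/funext => y; rewrite partial1of2E; case: (df y a).
  rewrite -[RHS]mulN1r -RintegralZl//; last exact: integrable_sin_normal_pdf.
  by apply: eq_Rintegral => y _; rewrite mulN1r.
(* Integrating factor of [F' = - s ^+ 2 * a * F]: [K] has derivative 0, so [K t = K 0 = cos c]. *)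
pose K a : R := (F a * expR (s ^+ 2 / 2 * a ^+ 2))%R.
have dK (a : R) : is_derive (a : R) (1 : R)%R K 0%R.
  have H1 := dF a.
  rewrite /K.
  have -> : (fun a0 => F a0 * expR (s ^+ 2 / 2 * a0 ^+ 2))%R =
    (F * (fun a0 => expR (s ^+ 2 / 2 * a0 ^+ 2)))%R by [].
  apply: is_derive_eq.
  by rewrite /GRing.scale/=; field.
have := is_derive_0_is_cst t 0%R dK.
rewrite /K expr0n/= mulr0 expR0 mulr1.
have -> : F 0%R = cos c.
  rewrite /F /f.
  under eq_Rintegral do rewrite mul0r add0r.
  rewrite RintegralZl//; last exact: integrable_normal_pdf.
  by rewrite /Rintegral integral_normal_pdf mulr1.
move=> e.
rewrite (@Rintegral_normal_prob s _ 1%R); last 2 first.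
- exact: measurable_cos_affine.
- by move=> x; exact: cos_max.
rewrite -/(F t) -e mulrCA -expRD.
have -> : (- (s ^+ 2 * t ^+ 2 / 2) + s ^+ 2 / 2 * t ^+ 2 = 0)%R by ring.
by rewrite expR0 mulr1.
Unshelve. all: by end_near. Qed.

End normal_characteristic.

(** * Normal random variables *)

Section elementary_bounds.
Context {R : realType}.
Implicit Types x y : R.

Lemma sinh_ge y : (0 <= y)%R -> (2 * y <= expR y - expR (- y))%R.
Proof.
rewrite le_eqVlt => /predU1P[<-|y0]; first by rewrite mulr0 oppr0 expR0 subrr.
pose g (u : R) : R := (expR u - expR (- u) - 2 * u)%R.
pose dg (u : R) : R := (expR u + expR (- u) - 2)%R.
have dG (u : R) : is_derive (u : R) (1 : R)%R g (dg u).
  rewrite /g; apply: is_derive_eq.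
  by rewrite /dg /GRing.scale/=; ring.
have cg : {within `[0%R, y], continuous g}.
  by apply: continuous_subspaceT; exact: is_derive_continuous.
have [c _] := MVT y0 (fun x _ => dG x) cg.
have dg0 : (0 <= dg c)%R.
  rewrite /dg {1 2}(splitr c) opprD !expRD.
  have := expRxMexpNx_1 (c / 2).
  set a := expR (c / 2); set b := expR _ => ab.
  have := sqr_ge0 (a - b); rewrite sqrrB ab !expr2; lra.
rewrite /g oppr0 expR0 mulr0 subrr !subr0 => E.
by have := mulr_ge0 dg0 (ltW y0); lra.
Qed.

(** [exp x + exp (- x) - 2] is the square of [exp (x / 2) - exp (- (x / 2))], to which [sinh_ge]
    applies. *)
Lemma cosh_ge x : (2 + x ^+ 2 <= expR x + expR (- x))%R.
Proof.
wlog x0 : x / (0 <= x)%R => [H|].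
  have [/H//|/ltW] := leP 0%R x.
  by rewrite -oppr_ge0 => /H; rewrite sqrrN opprK [(expR (- x) + _)%R]addrC.
have h0 : (0 <= x / 2)%R by lra.
have e1 : expR x = (expR (x / 2) * expR (x / 2))%R by rewrite -expRD -splitr.
have e2 : expR (- x) = (expR (- (x / 2)) * expR (- (x / 2)))%R.
  by rewrite -expRD -opprD -splitr.
have := sinh_ge h0; rewrite {}e1 {}e2.
have := expRxMexpNx_1 (x / 2).
set a := expR (x / 2); set b := expR _ => ab H.
have : (x ^+ 2 <= (a - b) ^+ 2)%R by rewrite lerXn2r ?nnegrE//; lra.
by rewrite sqrrB ab !expr2; lra.
Qed.

Lemma sin_le_id x : (0 <= x)%R -> (`|sin x| <= x)%R.
Proof.
rewrite le_eqVlt => /predU1P[<-|x0]; first by rewrite sin0 normr0.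
have cs : {within `[0%R, x], continuous (@sin R)}.
  by apply: continuous_subspaceT; exact: continuous_sin.
have [c _] := MVT x0 (fun x _ => is_derive_sin x) cs.
rewrite sin0 !subr0 => ->.
by rewrite normrM (gtr0_norm x0) ger_pMl// cos_max.
Qed.

Lemma cos_ge x : (1 - x ^+ 2 / 2 <= cos x)%R.
Proof.
wlog x0 : x / (0 <= x)%R => [H|].
  have [/H//|/ltW] := leP 0%R x.
  by rewrite -oppr_ge0 => /H; rewrite sqrrN cosN.
have h0 : (0 <= x / 2)%R by lra.
have := sin_le_id h0.
rewrite -(@ler_sqr _ _ (x / 2)%R) ?nnegrE// real_normK ?num_real//.
rewrite [in cos x](splitr x) cosD -!expr2 cos2sin2 expr_div_n => H.
lra.
Qed.

(** Replaces a limit [u -> 0]: inequalities between second moments are read off after dividing an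
    expansion in [u] by [u]. *)
Lemma le0_of_le_small (a k t : R) : (0 <= k)%R -> (0 < t)%R ->
  (forall u, (0 < u < t)%R -> (a <= k * u)%R) -> (a <= 0)%R.
Proof.
move=> k0 t0 H; rewrite leNgt; apply/negP => a0.
have ka : (0 < k + a / t)%R by rewrite ltr_wpDl// divr_gt0.
(* The term [a / t] in the denominator makes [a / (k + a / t)] at most [t], and its multiple by [k]
   at most [a], even when [k = 0]; halving makes both strict. *)
have := H (a / (k + a / t) / 2)%R.
have u0 : (0 < a / (k + a / t))%R by rewrite divr_gt0.
have ut : (a / (k + a / t) <= t)%R.
  rewrite ler_pdivrMr// mulrDr mulrCA divff ?gt_eqF// mulr1 lerDr.
  by rewrite mulr_ge0// ltW.
have -> : (0 < a / (k + a / t) / 2 < t)%R by lra.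
move=> /(_ isT).
have : (k * (a / (k + a / t)) <= a)%R.
  rewrite mulrA ler_pdivrMr// mulrC ler_pM2l// lerDl ltW// divr_gt0//.
by lra.
Qed.

End elementary_bounds.

Section normal_random_variable.
Context {R : realType} d (Omega : measurableType d) (P : probability Omega R).

(** Stated for arbitrary measures because independence is later used through it, with [P] restricted
    to an event on one side and a rescaled law on the other. *)
Lemma ge0_integral_law d' (T' : measurableType d') (mu : {measure set Omega -> \bar R})
    (m : {measure set T' -> \bar R}) (Y : Omega -> T') (f : T' -> \bar R) :
  measurable_fun setT Y ->
  (forall A, measurable A -> mu (Y @^-1` A) = m A) ->
  measurable_fun setT f -> (forall x, 0 <= f x) ->
  \int[mu]_w f (Y w) = \int[m]_x f x.
Proof.
move=> mY lawY mf f0.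
pose Y' : {mfun Omega >-> T'} := mfun_Sub (mem_set mY).
transitivity (\int[pushforward mu Y']_x f x).
  by rewrite ge0_integral_pushforward.
by apply: eq_measure_integral => A mA _; exact: lawY.
Qed.

Lemma Rintegral_law d' (T' : measurableType d') (mu : {measure set Omega -> \bar R})
    (m : {measure set T' -> \bar R}) (Y : Omega -> T') (f : T' -> R) :
  measurable_fun setT Y ->
  (forall A, measurable A -> mu (Y @^-1` A) = m A) ->
  measurable_fun setT f ->
  (\int[mu]_w f (Y w) = \int[m]_x f x)%R.
Proof.
move=> mY lawY mf; rewrite /Rintegral; congr fine.
rewrite [LHS]integralE [RHS]integralE; congr (_ - _).
  rewrite -(ge0_integral_law mY lawY)//; last first.
    by apply: measurable_funepos; exact/measurable_EFinP.
  by apply: eq_integral => w _; rewrite !funeposE.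
rewrite -(ge0_integral_law mY lawY)//; last first.
  by apply: measurable_funeneg; exact/measurable_EFinP.
by apply: eq_integral => w _; rewrite !funenegE.
Qed.

Lemma integral_probability_cst (r : R) : \int[P]_w r%:E = r%:E.
Proof.
rewrite integral_cst//; rewrite -[RHS]mule1; congr *%E.
exact: probability_setT.
Qed.

Lemma normal_rv_mgf (Y : Omega -> R) (m s : R) :
  measurable_fun setT Y ->
  (forall A, measurable A -> P (Y @^-1` A) = normal_law m s A) ->
  forall b, \int[P]_w (expR (b * Y w))%:E = (expR (m * b + s ^+ 2 * b ^+ 2 / 2))%:E.
Proof.
move=> mY.
have mE b : measurable_fun setT (fun x : R => (expR (b * x))%:E).
  by apply/measurable_EFinP/measurableT_comp => //; exact: measurable_funM.
rewrite /normal_law; case: (eqVneq s 0%R) => [-> lawY b|s0 lawY b].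
  rewrite (@ge0_integral_law _ _ P \d_m Y _ mY lawY (mE b))//.
  rewrite integral_dirac// /dirac indicE in_setT mul1e.
  by rewrite expr0n/= !mul0r addr0 mulrC.
rewrite (@ge0_integral_law _ _ P (normal_prob m s) Y _ mY lawY (mE b))//.
exact: normal_mgf.
Qed.

Lemma square_integrable_integrable (Y : Omega -> R) (q : R) :
  measurable_fun setT Y -> \int[P]_w (Y w ^+ 2)%:E = q%:E ->
  P.-integrable setT (fun w => (Y w)%:E) /\
  P.-integrable setT (fun w => (Y w ^+ 2)%:E).
Proof.
move=> mY YQ.
have i2 : P.-integrable setT (fun w => (Y w ^+ 2)%:E).
  apply/integrableP; split.
    by apply/measurable_EFinP; exact: measurable_funX.
  under eq_integral do rewrite gee0_abs ?lee_fin ?sqr_ge0//.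
  by rewrite YQ ltry.
split => //.
apply: (@le_integrable _ _ _ P setT measurableT _ (fun w => 1%:E + (Y w ^+ 2)%:E)).
- exact/measurable_EFinP.
- move=> w _; rewrite -EFinD lee_fin [leRHS]ger0_norm ?addr_ge0 ?sqr_ge0//.
  have := sqr_ge0 (`|Y w| - 1)%R; rewrite sqrrB1 real_normK ?num_real//.
  by have := normr_ge0 (Y w); lra.
- by apply: integrableD => //; exact: (finite_measure_integrable_cst P 1%R).
Qed.

(** The unknown parameters are pinned down by elementary inequalities integrated against the law:
    [exp x >= 1 + x] for the mean, and the quadratic bounds on [cos] and [cosh] for the two
    inequalities between [s ^+ 2] and [q]. *)
Lemma centered_normal_rvP (Y : Omega -> R) (q : R) :
  normal_rv P Y -> \int[P]_w (Y w)%:E = 0 -> \int[P]_w (Y w ^+ 2)%:E = q%:E ->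
  exists s : R, [/\ (s ^+ 2 = q)%R &
    forall A, measurable A -> P (Y @^-1` A) = normal_law 0 s A].
Proof.
move=> [mY [m [s lawY]]] Y0 YQ.
have [iY iY2] := square_integrable_integrable mY YQ.
have mgf := normal_rv_mgf mY lawY.
have m0 : m = 0%R.
  (* [E exp (b Y) >= 1] makes the exponent [m b + s^2 b^2 / 2] nonnegative for each [b]; at this [b]
     it is a negative multiple of [m ^+ 2]. Writing [1 + s ^+ 2] instead of [s ^+ 2] includes
     [s = 0]. *)
  pose b : R := (- m / (1 + s ^+ 2))%R.
  have : 1 <= \int[P]_w (expR (b * Y w))%:E.
    have -> : 1 = \int[P]_w (1%:E + b%:E * (Y w)%:E).
      rewrite integralD//; last 2 first.
      - exact: (finite_measure_integrable_cst P 1%R).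
      - by apply: integrableZl.
      by rewrite integralZl// Y0 mule0 adde0 integral_probability_cst.
    apply: le_integral => //.
    - apply: integrableD => //; first exact: (finite_measure_integrable_cst P 1%R).
      by apply: integrableZl.
    - apply/integrableP; split.
        by apply/measurable_EFinP/measurableT_comp => //; exact: measurable_funM.
      under eq_integral do rewrite gee0_abs ?lee_fin ?expR_ge0//.
      by rewrite mgf ltry.
    - by move=> w _; rewrite -EFinM -EFinD lee_fin expR_ge1Dx.
  rewrite mgf lee_fin -[X in (X <= _)%R -> _](expR0) ler_expR.
  rewrite /b => H.
  have s1 : (0 < 1 + s ^+ 2)%R by rewrite ltr_pwDl// sqr_ge0.
  have : (0 <= - (m ^+ 2 * (2 + s ^+ 2)))%R.
    have -> : (- (m ^+ 2 * (2 + s ^+ 2)) =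
      2 * (1 + s ^+ 2) ^+ 2 * (m * (- m / (1 + s ^+ 2)) + s ^+ 2 * (- m / (1 + s ^+ 2)) ^+ 2 / 2))%R.
      by field; rewrite gt_eqF.
    by rewrite mulr_ge0// mulr_ge0// sqr_ge0.
  rewrite oppr_ge0 pmulr_lle0; last by rewrite ltr_pwDl// sqr_ge0.
  by move=> m2; apply/eqP; rewrite -sqrf_eq0 eq_le m2 sqr_ge0.
subst m; exists s; split => //.
have q0 : (0 <= q)%R by rewrite -lee_fin -YQ integral_ge0// => w _; rewrite lee_fin sqr_ge0.
have s0 : (0 <= s ^+ 2)%R by exact: sqr_ge0.
have mcos t : measurable_fun setT (fun w => cos (t * Y w)).
  apply: (measurableT_comp (f := @cos R)); last exact: measurable_funM.
  by apply: continuous_measurable_fun; exact: continuous_cos.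
(* With [t ^+ 2 = 2 u], the bound on [cos] gives [1 - u q <= exp (- s^2 u) <= 1 / (1 + s^2 u)], that
   is [s^2 - q <= s^2 q u]; then [u] is arbitrarily small. *)
have lower : (s ^+ 2 <= q)%R.
  rewrite -subr_le0; apply: (@le0_of_le_small _ _ (s ^+ 2 * q)%R 1%R) => //.
    exact: mulr_ge0.
  move=> u /andP[u0 u1].
  pose t := Num.sqrt (2 * u).
  have t2 : (t ^+ 2 = 2 * u)%R by rewrite sqr_sqrtr// mulr_ge0// ltW.
  have Ecos : (\int[P]_w cos (t * Y w) = expR (- (s ^+ 2 * u)))%R.
    have mc : measurable_fun setT (fun x : R => cos (t * x)).
      apply: (measurableT_comp (f := @cos R)); last exact: measurable_funM.
      by apply: continuous_measurable_fun; exact: continuous_cos.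
    move: lawY; rewrite /normal_law; case: (eqVneq s 0%R) => [-> lawY|sn0 lawY].
      rewrite (@Rintegral_law _ _ P \d_(0%R : R) Y _ mY lawY mc) /Rintegral.
      rewrite integral_dirac//; last exact/measurable_EFinP.
      rewrite /dirac indicE in_setT mul1e /=.
      by rewrite mulr0 cos0 expr0n/= mul0r oppr0 expR0.
    rewrite (@Rintegral_law _ _ P (normal_prob 0 s) Y _ mY lawY mc).
    under eq_Rintegral do rewrite -[(t * _)%R]addr0.
    rewrite normal_characteristic// cos0 mulr1 t2; congr expR.
    by field.
  have : (1 - u * q <= expR (- (s ^+ 2 * u)))%R.
    rewrite -Ecos.
    have -> : (1 - u * q = \int[P]_w (1 - u * Y w ^+ 2))%R.
      rewrite RintegralB//; last 2 first.
      - exact: (finite_measure_integrable_cst P 1%R).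
      - by rewrite (_ : _ \o _ = fun w => u%:E * (Y w ^+ 2)%:E)//; apply: integrableZl.
      rewrite RintegralZl// {2}/Rintegral YQ/=.
      by rewrite /Rintegral integral_probability_cst.
    apply: le_Rintegral => //.
    - rewrite (_ : _ \o _ = fun w => 1%:E - u%:E * (Y w ^+ 2)%:E)//.
      apply: integrableB => //; first exact: (finite_measure_integrable_cst P 1%R).
      by apply: integrableZl.
    - by apply: (@bounded_integrable _ _ _ P _ 1%R) => // w; exact: cos_max.
    - move=> w _; have := cos_ge (t * Y w)%R; rewrite exprMn t2.
      by apply: le_trans; rewrite lerD2l lerN2; lra.
  rewrite expRN => H.
  have v0 : (0 <= s ^+ 2 * u)%R by rewrite mulr_ge0// ltW.
  have H2 : ((expR (s ^+ 2 * u))^-1 <= (1 + s ^+ 2 * u)^-1)%R.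
    by rewrite lef_pV2 ?posrE ?expR_gt0 ?expR_ge1Dx// ltr_pwDl.
  have := le_trans H H2.
  rewrite -div1r ler_pdivlMr ?ltr_pwDl// => H3.
  have : (u * (s ^+ 2 - q - s ^+ 2 * q * u) <= 0)%R by lra.
  by rewrite pmulr_rle0// subr_le0.
(* Symmetrically, [cosh_ge] gives [1 + u q <= exp (s^2 u)], which is multiplied by
   [1 - s^2 u <= exp (- s^2 u)]. The range [u < 1 / (1 + s^2)] keeps that factor positive. *)
have upper : (q <= s ^+ 2)%R.
  rewrite -subr_le0; apply: (@le0_of_le_small _ _ (s ^+ 2 * q)%R (1 + s ^+ 2)^-1%R) => //.
  - exact: mulr_ge0.
  - by rewrite invr_gt0 ltr_pwDl.
  move=> u /andP[u0 u1].
  have su1 : (s ^+ 2 * u < 1)%R.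
    move: u1; rewrite -div1r ltr_pdivlMr ?ltr_pwDl//; lra.
  pose t := Num.sqrt (2 * u).
  have t2 : (t ^+ 2 = 2 * u)%R by rewrite sqr_sqrtr// mulr_ge0// ltW.
  have Hint a : P.-integrable setT (fun w => (expR (a * Y w))%:E).
    apply/integrableP; split.
      by apply/measurable_EFinP/measurableT_comp => //; exact: measurable_funM.
    under eq_integral do rewrite gee0_abs ?lee_fin ?expR_ge0//.
    by rewrite mgf ltry.
  have : 2%:E + (2 * u * q)%:E <= \int[P]_w ((expR (t * Y w))%:E + (expR (- t * Y w))%:E).
    have -> : 2%:E + (2 * u * q)%:E = \int[P]_w (2%:E + (2 * u)%:E * (Y w ^+ 2)%:E).
      rewrite integralD//; last 2 first.
      - exact: (finite_measure_integrable_cst P 2%R).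
      - by apply: integrableZl.
      by rewrite integralZl// YQ integral_probability_cst -EFinM.
    apply: le_integral => //.
    - apply: integrableD => //; first exact: (finite_measure_integrable_cst P 2%R).
      by apply: integrableZl.
    - by apply: integrableD => //; exact: Hint.
    - move=> w _; rewrite -EFinM -!EFinD lee_fin mulNr.
      by have := cosh_ge (t * Y w)%R; rewrite exprMn t2.
  rewrite integralD// !mgf !mul0r !add0r sqrrN t2 -!EFinD lee_fin.
  have -> : (s ^+ 2 * (2 * u) / 2 = s ^+ 2 * u)%R by field.
  move=> H.
  have H2 : ((1 - s ^+ 2 * u) * (1 + u * q) <= 1)%R.
    have := expR_ge1Dx (- (s ^+ 2 * u))%R => H3.
    have H4 : (1 + u * q <= expR (s ^+ 2 * u))%R by lra.
    rewrite mulrC -[leRHS](expRxMexpNx_1 (s ^+ 2 * u)) ler_pM//.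
    - by rewrite addr_ge0// mulr_ge0// ltW.
    - lra.
  have : (u * (q - s ^+ 2 - s ^+ 2 * q * u) <= 0)%R by lra.
  by rewrite pmulr_rle0// subr_le0.
by apply/eqP; rewrite eq_le lower upper.
Qed.

(** The phase [c] encodes the real and imaginary parts of the characteristic function at once. The
    point mass is included, so singular covariance matrices need no separate treatment. *)
Lemma centered_normal_rv_cos (Y : Omega -> R) (q : R) :
  normal_rv P Y -> \int[P]_w (Y w)%:E = 0 -> \int[P]_w (Y w ^+ 2)%:E = q%:E ->
  forall c, (\int[P]_w cos (Y w + c) = expR (- (q / 2)) * cos c)%R.
Proof.
move=> nY Y0 YQ c.
have [s [<- lawY]] := centered_normal_rvP nY Y0 YQ.
have [mY _] := nY.
have mc : measurable_fun setT (fun x : R => cos (x + c)).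
  by under eq_fun do rewrite -[X in (X + _)%R]mul1r; exact: measurable_cos_affine.
move: lawY; rewrite /normal_law; case: (eqVneq s 0%R) => [-> lawY|sn0 lawY].
  rewrite (@Rintegral_law _ _ P \d_(0%R : R) Y _ mY lawY mc) /Rintegral.
  rewrite integral_dirac//; last exact/measurable_EFinP.
  rewrite /dirac indicE in_setT mul1e /=.
  by rewrite add0r expr0n/= mul0r oppr0 expR0 mul1r.
rewrite (@Rintegral_law _ _ P (normal_prob 0 s) Y _ mY lawY mc).
under eq_Rintegral do rewrite -[X in (X + _)%R]mul1r.
by rewrite normal_characteristic// expr1n mulr1.
Qed.

(** The parameter is known only through [s ^+ 2 = 1] and could be [-1]; the density sees only the
    square. *)
Lemma standard_normal_rv (Y : Omega -> R) :
  normal_rv P Y -> \int[P]_w (Y w)%:E = 0 -> \int[P]_w (Y w ^+ 2)%:E = 1 ->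
  forall A, measurable A -> P (Y @^-1` A) = normal_prob 0 1 A.
Proof.
move=> nY Y0 YQ A mA.
have [s [s1 ->//]] := centered_normal_rvP nY Y0 YQ.
have s0 : s != 0%R by rewrite -sqrf_eq0 s1 oner_eq0.
rewrite /normal_law (negbTE s0) /normal_prob; apply: eq_integral => x _.
by rewrite !normal_pdfE ?oner_eq0// /normal_peak /normal_fun s1 expr1n.
Qed.

End normal_random_variable.

(** * Uniqueness from cosine integrals *)

Section bounded_fubini.
Context {R : realType} d1 d2 (T1 : measurableType d1) (T2 : measurableType d2).
Variables (P1 : probability T1 R) (P2 : probability T2 R).

Lemma bounded_Rintegral d (T : measurableType d) (P : probability T R) (f : T -> R) (C : R) :
  measurable_fun setT f -> (forall x, (`|f x| <= C)%R) ->
  (\int[P]_x f x)%R%:E = \int[P]_x (f x)%:E.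
Proof.
move=> mf fC; rewrite /Rintegral fineK//.
exact: (integrable_fin_num measurableT (bounded_integrable P mf fC)).
Qed.

Lemma bounded_Rintegral_le d (T : measurableType d) (P : probability T R) (f : T -> R) (C : R) :
  measurable_fun setT f -> (forall x, (`|f x| <= C)%R) ->
  (`|\int[P]_x f x| <= C)%R.
Proof.
move=> mf fC; have iC := finite_measure_integrable_cst P C measurableT.
have intf := bounded_integrable P mf fC.
apply: (le_trans (le_normr_Rintegral measurableT intf)).
apply: (le_trans (le_Rintegral measurableT (integrable_norm intf) iC _)) => //.
  by move=> x _; exact: fC.
by rewrite /Rintegral/= (integral_probability_cst P C).
Qed.

Lemma bounded_Fubini1 (f : T1 * T2 -> R) (C : R) :
  measurable_fun setT f -> (forall x, (`|f x| <= C)%R) ->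
  (\int[P1]_x \int[P2]_y f (x, y) = \int[P1 \x P2]_z f z)%R.
Proof.
move=> mf fC; rewrite {1}/Rintegral [RHS]/Rintegral; congr fine.
have intf := bounded_integrable (P1 \x P2) mf fC.
rewrite -(integral12_prod_meas1 intf); apply: eq_integral => x _.
rewrite /fubini_F (@bounded_Rintegral _ _ P2 (fun y => f (x, y)) C)//.
by apply: measurableT_comp => //; exact: measurable_pair1.
Qed.

Lemma bounded_Fubini2 (f : T1 * T2 -> R) (C : R) :
  measurable_fun setT f -> (forall x, (`|f x| <= C)%R) ->
  (\int[P2]_y \int[P1]_x f (x, y) = \int[P1 \x P2]_z f z)%R.
Proof.
move=> mf fC; rewrite {1}/Rintegral [RHS]/Rintegral; congr fine.
have intf := bounded_integrable (P1 \x P2) mf fC.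
rewrite -(integral21_prod_meas1 intf); apply: eq_integral => x _.
rewrite /fubini_G (@bounded_Rintegral _ _ P1 (fun y => f (y, x)) C)//.
by apply: measurableT_comp => //; exact: measurable_pair2.
Qed.

End bounded_fubini.

Section normal_concentration.
Context {R : realType}.
Implicit Types x s e : R.

(** Chebyshev's inequality, with the square majorised by two exponentials through [cosh_ge]. Their
    means at [b = 1 / s] and [b = - 1 / s] are both [exp (1 / 2)], hence the constant; only the
    decay in [s / e] matters later. *)
Lemma normal_prob_tail x s e : (0 < s)%R -> (0 < e)%R ->
  normal_prob x s [set y | (e <= `|y - x|)%R] <=
  (2 * expR (2^-1) * (s ^+ 2 / e ^+ 2))%:E.
Proof.
move=> s0 e0; set A := [set y | _].
have mA : measurable A.
  rewrite (_ : A = (fun y => `|y - x|)%R @^-1` `[e, +oo[%classic); last first.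
    by apply/seteqP; split => y /=; rewrite in_itv/= andbT.
  rewrite -[X in measurable X]setTI.
  have mabs : measurable_fun setT (fun y : R => `|y - x|%R).
    apply: (measurableT_comp (@normr_measurable R setT)); exact: measurable_funB.
  exact: mabs.
pose g y : R := (s ^+ 2 / e ^+ 2 * (expR (s^-1 * (y - x)) + expR (- s^-1 * (y - x))))%R.
have mexp (b : R) : measurable_fun setT (fun y : R => expR (b * (y - x))).
  by apply: measurableT_comp => //; apply: measurable_funM => //; exact: measurable_funB.
have mEexp (b : R) : measurable_fun setT (fun y : R => (expR (b * (y - x)))%:E).
  by apply/measurable_EFinP; exact: mexp.
have mg : measurable_fun setT g by apply: measurable_funM => //; exact: measurable_funD.
have E (b : R) : \int[normal_prob x s]_y (expR (b * (y - x)))%:E = (expR (s ^+ 2 * b ^+ 2 / 2))%:E.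
  under eq_integral do rewrite mulrBr expRD mulrC EFinM.
  rewrite ge0_integralZl//.
  - rewrite normal_mgf ?gt_eqF// -EFinM -expRD; congr (expR _)%:E.
    by rewrite mulrC; ring.
  - by apply/measurable_EFinP/measurableT_comp => //; exact: measurable_funM.
have -> : (2 * expR 2^-1 * (s ^+ 2 / e ^+ 2))%:E = \int[normal_prob x s]_y (g y)%:E.
  rewrite /g; under eq_integral do rewrite EFinM EFinD.
  rewrite ge0_integralZl//; last 3 first.
  - by apply: emeasurable_funD; exact: mEexp.
  - by move=> y _; rewrite -EFinD lee_fin addr_ge0// expR_ge0.
  - by rewrite lee_fin divr_ge0// sqr_ge0.
  rewrite ge0_integralD//; [|exact: mEexp|exact: mEexp].
  rewrite !E sqrrN exprVn divff ?gt_eqF ?exprn_gt0// -EFinD -EFinM; congr EFin.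
  by rewrite div1r mulrC; ring.
rewrite -(setIT A) -integral_indic//.
apply: ge0_le_integral => //.
- exact/measurable_EFinP.
- exact/measurable_EFinP.
- move=> y _; rewrite lee_fin indicE.
  have g0 : (0 <= g y)%R by rewrite mulr_ge0 ?divr_ge0 ?sqr_ge0// addr_ge0 ?expR_ge0.
  case: (boolP (y \in A)) => [/set_mem|_]//=; rewrite /A/= => ey.
  have := cosh_ge (s^-1 * (y - x))%R; rewrite -mulNr => H.
  have : (s ^+ 2 / e ^+ 2 * (s^-1 * (y - x)) ^+ 2 <= g y)%R.
    rewrite /g ler_wpM2l ?divr_ge0 ?sqr_ge0//; lra.
  apply: le_trans.
  have -> : (s ^+ 2 / e ^+ 2 * (s^-1 * (y - x)) ^+ 2 = `|y - x| ^+ 2 / e ^+ 2)%R.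
    by rewrite real_normK ?num_real//; field; rewrite !gt_eqF.
  by rewrite ler_pdivlMr ?exprn_gt0// mul1r lerXn2r// nnegrE ltW.
Qed.

End normal_concentration.

(** * Smoothing indicators of intervals by narrow normal laws *)

Section gaussian_smoothing.
Context {R : realType} d (T : measurableType d) (P : probability T R).
Variables (w Y : T -> R) (C : R).
Hypotheses (mw : measurable_fun setT w) (wC : forall x, (`|w x| <= C)%R).
Hypothesis mY : measurable_fun setT Y.

(** One function read in two ways: as the characteristic function of N(0, s^2) at [x - y] it is an
    average of cosines, and up to [normal_peak] it is the density at [y] of a normal law centred at
    [x] with standard deviation [1 / s]. *)
Let gauss s (x y : R) : R := expR (- (s ^+ 2 * (x - y) ^+ 2 / 2)).

Let C0 : (0 <= C)%R.
Proof. exact: le_trans (normr_ge0 _) (wC point). Qed.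

Let weighted_le (f : R) x : (`|f| <= 1)%R -> (`|w x * f| <= C)%R.
Proof.
move=> f1; rewrite normrM -[leRHS]mulr1.
by rewrite ler_pM.
Qed.

Let gauss_le1 s x y : (`|gauss s x y| <= 1)%R.
Proof.
rewrite ger0_norm ?expR_ge0// -[leRHS]expR0 ler_expR oppr_le0.
by rewrite divr_ge0// mulr_ge0 ?sqr_ge0.
Qed.

Lemma gaussian_smoothing_cos s y : s != 0%R ->
  (\int[P]_x (w x * gauss s (Y x) y) =
   \int[normal_prob 0 s]_u \int[P]_x (w x * cos (u * Y x + - (u * y))))%R.
Proof.
move=> s0.
pose f (z : T * R) : R := (w z.1 * cos (z.2 * Y z.1 + - (z.2 * y)))%R.
have mf : measurable_fun setT f.
  apply: measurable_funM; first exact: measurableT_comp.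
  apply: (measurableT_comp (f := @cos R)).
    by apply: continuous_measurable_fun; exact: continuous_cos.
  apply: measurable_funD.
    by apply: measurable_funM => //; exact: measurableT_comp.
  by apply: measurableT_comp => //; exact: measurable_funM.
have fC z : (`|f z| <= C)%R by apply: weighted_le; exact: cos_max.
rewrite [RHS](bounded_Fubini2 P (normal_prob 0 s) mf fC).
rewrite -(bounded_Fubini1 P (normal_prob 0 s) mf fC).
apply: eq_Rintegral => x _; rewrite /f/=.
have mc : measurable_fun setT (fun u : R => cos ((Y x - y) * u + 0)).
  exact: measurable_cos_affine.
transitivity (w x * \int[normal_prob 0 s]_u cos ((Y x - y) * u + 0))%R.
  rewrite normal_characteristic// cos0 mulr1 /gauss.
  by [].
rewrite -RintegralZl//; last first.
  by apply: (bounded_integrable (normal_prob 0 s) (C := 1%R) mc) => u; exact: cos_max.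
apply: eq_Rintegral => u _; congr (_ * cos _)%R.
by rewrite addr0 mulrC mulrBr.
Qed.

Lemma normal_pdf_gauss s x y : s != 0%R ->
  normal_pdf x s y = (normal_peak s * gauss s^-1 x y)%R.
Proof.
move=> s0; rewrite normal_pdfE// /normal_fun /gauss; congr (_ * expR _)%R.
by field.
Qed.

(** Passing to the uniform law on the interval keeps both factors probability measures, so that the
    bounded Fubini lemmas apply. *)
Lemma normal_prob_itv_uniform s a b x (ab : (a < b)%R) : s != 0%R ->
  normal_prob x s `[a, b]%classic =
  ((b - a) * normal_peak s)%:E * \int[uniform_prob ab]_y (gauss s^-1 x y)%:E.
Proof.
move=> s0.
have mg : measurable_fun setT (fun y => (gauss s^-1 x y)%:E).
  apply/measurable_EFinP/measurableT_comp => //; apply: measurableT_comp => //.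
  apply: measurable_funM => //; apply: measurable_funM => //.
  by apply: measurable_funX; exact: measurable_funB.
rewrite integral_uniform//; last by move=> y; rewrite lee_fin expR_ge0.
rewrite muleA -EFinM mulrAC -mulrA mulrA [((b - a) / _)%R]divff; last by rewrite gt_eqF// subr_gt0.
rewrite mul1r -ge0_integralZl//; last 3 first.
- exact: measurable_funTS.
- by move=> y _; rewrite lee_fin expR_ge0.
- by rewrite lee_fin normal_peak_ge0.
by apply: eq_integral => y _; rewrite normal_pdf_gauss.
Qed.

Let gaussE s a b (ab : (a < b)%R) : s != 0%R -> forall x,
  fine (normal_prob x s `[a, b]%classic) =
  ((b - a) * normal_peak s * \int[uniform_prob ab]_y gauss s^-1 x y)%R.
Proof.
move=> s0 x.
have mg : measurable_fun setT (gauss s^-1 x).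
  apply/measurableT_comp => //; apply: measurableT_comp => //.
  apply: measurable_funM => //; apply: measurable_funM => //.
  by apply: measurable_funX; exact: measurable_funB.
by rewrite (normal_prob_itv_uniform x ab s0) -(bounded_Rintegral (uniform_prob ab) mg (@gauss_le1 s^-1 x)) -EFinM.
Qed.

Lemma measurable_normal_prob_itv (s a b : R) : (a < b)%R -> s != 0%R ->
  measurable_fun setT (fun x => fine (normal_prob x s `[a, b]%classic)).
Proof.
move=> ab s0; apply: (measurableT_comp (f := @fine R)) => //.
under eq_fun do rewrite (normal_prob_itv_uniform _ ab s0).
apply: emeasurable_funM => //.
have mg : measurable_fun setT (fun z : R * R => (gauss s^-1 z.1 z.2)%:E).
  apply/measurable_EFinP/measurableT_comp => //; apply: measurableT_comp => //.
  apply: measurable_funM => //; apply: measurable_funM => //.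
  by apply: measurable_funX; exact: measurable_funB.
have g0 (z : R * R) : 0 <= (gauss s^-1 z.1 z.2)%:E by rewrite lee_fin expR_ge0.
exact: (@measurable_fun_fubini_tonelli_F _ _ _ _ R (uniform_prob ab) _ mg g0).
Qed.

Lemma Rintegral_normal_prob_itv (s a b : R) (ab : (a < b)%R) : s != 0%R ->
  (\int[P]_x (w x * fine (normal_prob (Y x) s `[a, b]%classic)) =
   (b - a) * normal_peak s *
   \int[uniform_prob ab]_y \int[P]_x (w x * gauss s^-1 (Y x) y))%R.
Proof.
move=> s0.
pose f (z : T * R) : R := (w z.1 * gauss s^-1 (Y z.1) z.2)%R.
have mf : measurable_fun setT f.
  apply: measurable_funM; first exact: measurableT_comp.
  apply/measurableT_comp => //; apply: measurableT_comp => //.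
  apply: measurable_funM => //; apply: measurable_funM => //.
  apply: measurable_funX; apply: measurable_funB => //.
  exact: measurableT_comp.
have fC z : (`|f z| <= C)%R by apply: weighted_le; exact: gauss_le1.
rewrite [X in (_ = _ * X)%R](bounded_Fubini2 P (uniform_prob ab) mf fC).
rewrite -(bounded_Fubini1 P (uniform_prob ab) mf fC) /f/=.
have mg x : measurable_fun setT (gauss s^-1 x).
  apply/measurableT_comp => //; apply: measurableT_comp => //.
  apply: measurable_funM => //; apply: measurable_funM => //.
  by apply: measurable_funX; exact: measurable_funB.
have E x : (\int[uniform_prob ab]_y (w x * gauss s^-1 (Y x) y) =
   w x * \int[uniform_prob ab]_y gauss s^-1 (Y x) y)%R.
  rewrite RintegralZl//.
  by apply: (bounded_integrable (uniform_prob ab) (C := 1%R) (mg _)) => u; exact: gauss_le1.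
under [in RHS]eq_Rintegral do rewrite E.
rewrite -RintegralZl//.
  by apply: eq_Rintegral => x _; rewrite (gaussE ab s0) mulrCA.
apply: (@bounded_integrable _ _ _ P _ C).
  apply: measurable_funM => //.
  apply: (measurableT_comp (f := @fine R)) => //.
  have mg' : measurable_fun setT (fun z : T * R => (gauss s^-1 (Y z.1) z.2)%:E).
    apply/measurable_EFinP/measurableT_comp => //; apply: measurableT_comp => //.
    apply: measurable_funM => //; apply: measurable_funM => //.
    by apply: measurable_funX; apply: measurable_funB => //; exact: measurableT_comp.
  have g0 (z : T * R) : 0 <= (gauss s^-1 (Y z.1) z.2)%:E by rewrite lee_fin expR_ge0.
  exact: (@measurable_fun_fubini_tonelli_F _ _ _ _ R (uniform_prob ab) _ mg' g0).
move=> x; apply: weighted_le.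
by apply: (bounded_Rintegral_le (uniform_prob ab) (mg _)) => u; exact: gauss_le1.
Qed.

Lemma cvg_Rintegral_bounded (f_ : nat -> T -> R) (f : T -> R) (D : R) :
  (forall n, measurable_fun setT (f_ n)) ->
  (forall n x, (`|f_ n x| <= D)%R) ->
  (forall x, f_ n x @[n --> \oo] --> f x) ->
  (\int[P]_x f_ n x)%R @[n --> \oo] --> (\int[P]_x f x)%R.
Proof.
move=> mf fD ff.
have mlim : measurable_fun setT f.
  by apply: (@measurable_realfun.measurable_fun_cvg _ _ _ setT f_) => // x _; exact: ff.
have fD' x : (`|f x| <= D)%R.
  have cf : `|f_ n x|%R @[n --> \oo] --> `|f x|%R by apply: cvg_norm; exact: ff.
  rewrite -(cvg_lim _ cf)//; apply: limr_le; first by apply: cvgP cf.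
  by apply: nearW => n; exact: fD.
apply: fine_cvg; rewrite (bounded_Rintegral P mlim fD').
apply: (@dominated_cvg _ _ _ P setT measurableT (fun n x => (f_ n x)%:E) _ (fun=> D%:E)) => //.
- by move=> n; exact/measurable_EFinP.
- by move=> x _; apply: cvg_EFin; [exact: nearW|exact: ff].
- exact: (finite_measure_integrable_cst P D measurableT).
- by move=> n x _; rewrite lee_fin.
Qed.

(** The interval moves right by [e = 1 / (n + 1)] while the standard deviation is [e ^+ 2], much
    smaller than the shift. Hence [a] is eventually excluded and [b] included: the limit is the
    indicator of a half-open interval at every point, endpoints too. The tail bound becomes
    [K * e ^+ 2]. *)
Lemma cvg_normal_prob_itv (a b x : R) : (a < b)%R ->
  fine (normal_prob x (n.+1%:R^-1 ^+ 2) `[(a + n.+1%:R^-1)%R, (b + n.+1%:R^-1)%R]%classic)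
    @[n --> \oo] --> (\1_(`]a, b]%classic) x : R).
Proof.
move=> ab.
pose e n : R := (n.+1%:R^-1)%R.
have e0 n : (0 < e n)%R by rewrite invr_gt0.
have ecvg : e n @[n --> \oo] --> (0 : R)%R by exact: cvg_harmonic.
pose K : R := (2 * expR 2^-1)%R.
pose F n := [set y : R | (e n <= `|y - x|)%R].
have mF n : measurable (F n).
  rewrite (_ : F n = (fun y => `|y - x|)%R @^-1` `[e n, +oo[%classic); last first.
    by apply/seteqP; split => y /=; rewrite in_itv/= andbT.
  rewrite -[X in measurable X]setTI.
  have mabs : measurable_fun setT (fun y : R => `|y - x|%R).
    apply: (measurableT_comp (@normr_measurable R setT)); exact: measurable_funB.
  exact: mabs.
have tail n : normal_prob x (e n ^+ 2) (F n) <= (K * e n ^+ 2)%:E.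
  apply: (le_trans (normal_prob_tail x _ _)) => //; first exact: exprn_gt0.
  by rewrite lee_fin /K (expr2 (e n ^+ 2)) mulfK// expf_neq0// gt_eqF.
pose I n := `[(a + e n)%R, (b + e n)%R]%classic.
suff: (\1_(`]a, b]%classic) x - fine (normal_prob x (e n ^+ 2) (I n)))%R @[n --> \oo] --> (0 : R)%R.
  move=> H; pose i : R := \1_(`]a, b]%classic) x.
  pose p n : R := fine (normal_prob x (e n ^+ 2) (I n)).
  suff: p n @[n --> \oo] --> i by [].
  have -> : p = (fun n => i - (i - p n))%R by apply/funext => n; rewrite subKr.
  by rewrite -[X in _ --> X]subr0; apply: cvgB => //; exact: cvg_cst.
apply: norm_cvg0.
apply: (@squeeze_cvgr _ _ _ _ (fun=> 0%R) (fun n => K * e n ^+ 2)%R); last 2 first.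
- exact: cvg_cst.
- rewrite -[X in _ --> X](mulr0 K) -(mulr0 0%R).
  by apply: cvgMr; under eq_cvg do rewrite expr2; exact: cvgM.
have fin n A : measurable A -> normal_prob x (e n ^+ 2) A \is a fin_num.
  by move=> mA; exact: fin_num_measure.
have mI n : measurable (I n) by exact: measurable_itv.
have [/andP[ax xb]|xab] := boolP ((a < x)%R && (x <= b)%R).
  rewrite indicE mem_set/=; last by rewrite in_itv/= ax xb.
  near=> n; rewrite normr_ge0/=.
  have -> : fine (normal_prob x (e n ^+ 2) (I n)) =
            (1 - fine (normal_prob x (e n ^+ 2) (~` I n)))%R.
    have -> : normal_prob x (e n ^+ 2) (~` I n) = 1 - normal_prob x (e n ^+ 2) (I n).
      by apply: probability_setC; exact: measurable_itv.
    have := fineK (fin n (I n) (mI n)); set z := normal_prob _ _ _ => zE.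
    by rewrite -zE /= subKr.
  rewrite opprB addrCA subrr addr0 ger0_norm; last by apply: fine_ge0; exact: measure_ge0.
  rewrite -lee_fin fineK; last by apply: fin; apply: measurableC; exact: mI.
  apply: (le_trans _ (tail n)).
  apply: le_measure.
  - by rewrite inE; apply: measurableC; exact: mI.
  - by rewrite inE; exact: mF.
  move=> y; rewrite /I /setC /= in_itv/= => /negP; rewrite negb_and -!ltNge => H.
  have en : (e n < (x - a) / 2)%R.
    by near: n; apply: (cvgr_lt (0 : R)%R ecvg); lra.
  rewrite /F/=; case/orP: H => H.
    by rewrite distrC ger0_norm; lra.
  by rewrite ger0_norm; [lra|have := e0 n; lra].
rewrite indicE memNset/=; last by rewrite in_itv/=; exact/negP.
have sub : \forall n \near \oo, I n `<=` F n.
  move: xab; rewrite negb_and -!leNgt => /orP[xa|bx].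
    apply: nearW => n y; rewrite /I /F/= in_itv/= => /andP[H _].
    by rewrite ger0_norm; [lra|have := e0 n; lra].
  near=> n; move=> y; rewrite /I /F/= in_itv/= => /andP[_ H].
  have en : (e n < (x - b) / 2)%R.
    near: n; apply: (cvgr_lt (0 : R)%R ecvg); rewrite -ltNge in bx; lra.
  by rewrite distrC ger0_norm; lra.
near=> n; rewrite normr_ge0/= sub0r normrN ger0_norm; last by apply: fine_ge0; exact: measure_ge0.
rewrite -lee_fin fineK; last by apply: fin; exact: mI.
apply: (le_trans _ (tail n)).
apply: le_measure.
- by rewrite inE; exact: mI.
- by rewrite inE; exact: mF.
- by near: n.
Unshelve. all: by end_near. Qed.

End gaussian_smoothing.

(** * Uniqueness for bounded signed weights *)

Section characteristic_uniqueness.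
Context {R : realType}.

Lemma measurable_indic_comp d (T : measurableType d) (Y : T -> R) (A : set R) :
  measurable_fun setT Y -> measurable A ->
  measurable_fun setT (fun x => \1_A (Y x) : R).
Proof. by move=> mY mA; apply: measurableT_comp => //; exact: measurable_indic. Qed.

Lemma indic_norm_le1 (T : Type) (A : set T) (x : T) : (`|\1_A x : R| <= 1)%R.
Proof. by rewrite indicE; case: (_ \in _); rewrite ?normr1// normr0. Qed.

Lemma Rintegral_weight_itv_cvg d (T : measurableType d) (P : probability T R)
    (w Y : T -> R) (C a b : R) :
  measurable_fun setT w -> (forall x, (`|w x| <= C)%R) -> measurable_fun setT Y ->
  (a < b)%R ->
  (\int[P]_x (w x * fine (normal_prob (Y x) (n.+1%:R^-1 ^+ 2)
     `[(a + n.+1%:R^-1)%R, (b + n.+1%:R^-1)%R]%classic)))%R @[n --> \oo] -->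
  (\int[P]_x (w x * \1_(`]a, b]%classic) (Y x)))%R.
Proof.
move=> mw wC mY ab.
apply: (@cvg_Rintegral_bounded _ _ _ P _ _ C).
- move=> n; apply: measurable_funM => //.
  apply: (measurableT_comp (measurable_normal_prob_itv _ _) mY).
  + by rewrite ltrD2r.
  + by rewrite expf_neq0// invr_neq0.
- move=> n x; rewrite normrM -[leRHS]mulr1 ler_pM//.
  rewrite ger0_norm; last by apply: fine_ge0; exact: measure_ge0.
  have mI : measurable (`[(a + n.+1%:R^-1)%R, (b + n.+1%:R^-1)%R]%classic : set R).
    exact: measurable_itv.
  rewrite -lee_fin fineK; first exact: probability_le1.
  exact: fin_num_measure.
- move=> x; apply: cvgM; first exact: cvg_cst.
  exact: cvg_normal_prob_itv.
Qed.

Lemma eq_cvg_unique (u v : nat -> R) (l1 l2 : R) : (forall n, u n = v n) ->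
  u @ \oo --> l1 -> v @ \oo --> l2 -> l1 = l2.
Proof. by move=> /funext ->; exact: cvg_unique. Qed.

Context d1 d2 (T1 : measurableType d1) (T2 : measurableType d2).
Variables (P1 : probability T1 R) (P2 : probability T2 R).

(* The weights are only bounded, not nonnegative: this is what lets the
   uniqueness theorem be applied one coordinate at a time. *)
Lemma weighted_cos_unique (w1 Y1 : T1 -> R) (w2 Y2 : T2 -> R) (C : R) :
  measurable_fun setT w1 -> (forall x, (`|w1 x| <= C)%R) -> measurable_fun setT Y1 ->
  measurable_fun setT w2 -> (forall x, (`|w2 x| <= C)%R) -> measurable_fun setT Y2 ->
  (forall t c, \int[P1]_x (w1 x * cos (t * Y1 x + c)) =
               \int[P2]_x (w2 x * cos (t * Y2 x + c)))%R ->
  forall A, measurable A ->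
  (\int[P1]_x (w1 x * \1_A (Y1 x)) = \int[P2]_x (w2 x * \1_A (Y2 x)))%R.
Proof.
move=> mw1 wC1 mY1 mw2 wC2 mY2 H.
(* Frequency 0 shows equality of the total weights; with signed weights this is what complements
   need in the Dynkin argument. *)
have HT : (\int[P1]_x w1 x = \int[P2]_x w2 x)%R.
  have := H 0%R 0%R.
  under eq_Rintegral do rewrite mul0r addr0 cos0 mulr1.
  by under [in RHS]eq_Rintegral do rewrite mul0r addr0 cos0 mulr1.
(* The smoothed indicators have equal integrals for each [n], since by Fubini they are mixtures of
   the cosine integrals in [H]; the limit transfers this to the interval. *)
have step a b : (\int[P1]_x (w1 x * \1_(`]a, b]%classic) (Y1 x)) =
    \int[P2]_x (w2 x * \1_(`]a, b]%classic) (Y2 x)))%R.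
  have [ab|ba] := ltP a b; last first.
    rewrite set_itv_ge ?bnd_simp -?leNgt//.
    under eq_Rintegral do rewrite indic0 mulr0.
    under [RHS]eq_Rintegral do rewrite indic0 mulr0.
    by rewrite /Rintegral !integral0.
  have L1 := Rintegral_weight_itv_cvg (P := P1) mw1 wC1 mY1 ab.
  have L2 := Rintegral_weight_itv_cvg (P := P2) mw2 wC2 mY2 ab.
  apply: (eq_cvg_unique _ L1 L2) => n.
  have s0 : (n.+1%:R^-1 ^+ 2 != 0 :> R)%R by rewrite expf_neq0// invr_neq0.
  have ab' : (a + n.+1%:R^-1 < b + n.+1%:R^-1)%R by rewrite ltrD2r.
  rewrite (Rintegral_normal_prob_itv P1 mw1 wC1 mY1 ab' s0).
  rewrite (Rintegral_normal_prob_itv P2 mw2 wC2 mY2 ab' s0).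
  congr (_ * _)%R; apply: eq_Rintegral => y _.
  rewrite (gaussian_smoothing_cos P1 mw1 wC1 mY1 y (invr_neq0 s0)).
  rewrite (gaussian_smoothing_cos P2 mw2 wC2 mY2 y (invr_neq0 s0)).
  by apply: eq_Rintegral => u _; exact: H.
have mwi d (T : measurableType d) (w Y : T -> R) (S : set R) :
    measurable_fun setT w -> measurable_fun setT Y -> measurable S ->
    measurable_fun setT (fun x => w x * \1_S (Y x))%R.
  by move=> mw mY mS; apply: measurable_funM => //; exact: measurable_indic_comp.
have wiC (T : Type) (w Y : T -> R) (S : set R) :
    (forall x, (`|w x| <= C)%R) -> forall x, (`|w x * \1_S (Y x)| <= C)%R.
  by move=> wC x; rewrite normrM -[leRHS]mulr1 ler_pM// indic_norm_le1.
move=> A mA.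
pose Q (S : set R) := (\int[P1]_x (w1 x * \1_S (Y1 x)) = \int[P2]_x (w2 x * \1_S (Y2 x)))%R.
apply: (@dynkin_induction _ _ (@ocitv R) Q) => //.
- exact: ocitvI.
- rewrite /Q; under eq_Rintegral do rewrite indicT mulr1.
  by under [RHS]eq_Rintegral do rewrite indicT mulr1.
- by move=> _ [[a b] _ <-]; exact: step.
- move=> S mS QS; rewrite /Q.
  have E d (T : measurableType d) (P : probability T R) (w Y : T -> R) :
      measurable_fun setT w -> (forall x, (`|w x| <= C)%R) -> measurable_fun setT Y ->
      (\int[P]_x (w x * \1_(~` S) (Y x)) = \int[P]_x w x - \int[P]_x (w x * \1_S (Y x)))%R.
    move=> mw wC mY; rewrite -RintegralB//.
    + apply: eq_Rintegral => x _; rewrite !indicE in_setC.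
      by case: (_ \in _) => /=; rewrite ?mulr0 ?mulr1 ?subrr ?subr0.
    + exact: (bounded_integrable P mw wC).
    + apply: (bounded_integrable P (C := C)); [exact: mwi|exact: wiC].
  by rewrite !E// HT QS.
- move=> F mF tF QF; rewrite /Q.
  have E d (T : measurableType d) (P : probability T R) (w Y : T -> R) :
      measurable_fun setT w -> (forall x, (`|w x| <= C)%R) -> measurable_fun setT Y ->
      (\sum_(0 <= k < n) \int[P]_x (w x * \1_(F k) (Y x)))%R @[n --> \oo] -->
      (\int[P]_x (w x * \1_(\bigcup_k F k) (Y x)))%R.
    move=> mw wC mY.
    pose U n := \bigcup_(k in `I_n) F k.
    have mU n : measurable (U n) by apply: bigcup_measurable.
    have sumE n : (\sum_(0 <= k < n) \int[P]_x (w x * \1_(F k) (Y x)) =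
       \int[P]_x (w x * \1_(U n) (Y x)))%R.
      elim: n => [|n IH].
        rewrite big_geq// /U II0 bigcup_set0; under eq_Rintegral do rewrite indic0 mulr0.
        by rewrite /Rintegral integral0.
      rewrite big_nat_recr//= IH -RintegralD//; last 2 first.
      + by apply: (bounded_integrable P (C := C)); [exact: mwi|exact: wiC].
      + by apply: (bounded_integrable P (C := C)); [exact: mwi|exact: wiC].
      apply: eq_Rintegral => x _; rewrite -mulrDr; congr (_ * _)%R.
      rewrite !indicE.
      have [yF|yF] := boolP (Y x \in F n).
        rewrite (memNset (A := U n)); last first.
          move=> [k /= kn Fk]; move/set_mem : yF => yF.
          have kn' : k = n by apply: (tF k n I I); exists (Y x).
          by rewrite kn' ltnn in kn.
        rewrite mem_set ?add0r//; exists n => //=; exact/set_mem.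
      rewrite addr0; congr ((nat_of_bool _)%:R); apply/idP/idP.
        by move=> /set_mem[k /= kn Fk]; apply/mem_set; exists k => //=; exact: leqW.
      move=> /set_mem[k /=]; rewrite ltnS leq_eqVlt => /predU1P[->|kn] Fk.
        by move/mem_set : Fk; rewrite (negbTE yF).
      by apply/mem_set; exists k.
    have := @cvg_Rintegral_bounded _ _ _ P (fun n x => w x * \1_(U n) (Y x))%R
      (fun x => w x * \1_(\bigcup_k F k) (Y x))%R C.
    rewrite (_ : (fun n => \int[P]_x (w x * \1_(U n) (Y x)))%R =
      (fun n => \sum_(0 <= k < n) \int[P]_x (w x * \1_(F k) (Y x)))%R); last first.
      by apply/funext => n; rewrite sumE.
    apply.
    + by move=> n; exact: mwi.
    + by move=> n x; exact: wiC.
    + move=> x; apply: cvgM; first exact: cvg_cst.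
      have [[k _ Fk]|nF] := pselect ((\bigcup_k F k) (Y x)).
        rewrite indicE mem_set; last by exists k.
        apply: cvg_near_cst; exists k.+1 => // n /= kn.
        by rewrite indicE mem_set//; exists k.
      rewrite indicE memNset//.
      apply: cvg_near_cst; apply: nearW => n.
      by rewrite indicE memNset// => -[k _ Fk]; apply: nF; exists k.
  apply: (eq_cvg_unique _ (E _ _ P1 _ _ mw1 wC1 mY1) (E _ _ P2 _ _ mw2 wC2 mY2)) => n.
  by apply: eq_bigr => k _; exact: QF.
Qed.

Lemma cosM (x y : R) : (cos x * cos y = 2^-1 * (cos (x + y) + cos (x - y)))%R.
Proof. by rewrite cosD cosB; field. Qed.

(* Coordinate by coordinate: [cosM] keeps the hypothesis stable when the weight
   absorbs the cosine of the remaining coordinates. *)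
Lemma weighted_vector_unique n (Y1 : 'I_n -> T1 -> R) (Y2 : 'I_n -> T2 -> R)
    (A : 'I_n -> set R) :
  (forall i, measurable_fun setT (Y1 i)) -> (forall i, measurable_fun setT (Y2 i)) ->
  (forall i, measurable (A i)) ->
  forall (w1 : T1 -> R) (w2 : T2 -> R) (C : R),
  measurable_fun setT w1 -> (forall x, (`|w1 x| <= C)%R) ->
  measurable_fun setT w2 -> (forall x, (`|w2 x| <= C)%R) ->
  (forall a c, \int[P1]_x (w1 x * cos (\sum_(i < n) a i * Y1 i x + c)) =
               \int[P2]_x (w2 x * cos (\sum_(i < n) a i * Y2 i x + c)))%R ->
  (\int[P1]_x (w1 x * \prod_(i < n) \1_(A i) (Y1 i x)) =
   \int[P2]_x (w2 x * \prod_(i < n) \1_(A i) (Y2 i x)))%R.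
Proof.
elim: n Y1 Y2 A => [|n IH] Y1 Y2 A mY1 mY2 mA w1 w2 C mw1 wC1 mw2 wC2 H.
  have := H (fun=> 0%R) 0%R.
  under eq_Rintegral do rewrite big_ord0 addr0 cos0.
  under [in X in _ = X -> _]eq_Rintegral do rewrite big_ord0 addr0 cos0.
  move=> E; under eq_Rintegral do rewrite big_ord0.
  by under [RHS]eq_Rintegral do rewrite big_ord0.
under eq_Rintegral do rewrite big_ord_recl mulrA.
under [RHS]eq_Rintegral do rewrite big_ord_recl mulrA.
have mcos d (T : measurableType d) (Y : 'I_n -> T -> R) (a : 'I_n -> R) c :
    (forall i, measurable_fun setT (Y i)) ->
    measurable_fun setT (fun x => cos (\sum_(i < n) a i * Y i x + c))%R.
  move=> mY; apply: (measurableT_comp (f := @cos R)).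
    by apply: continuous_measurable_fun; exact: continuous_cos.
  apply: measurable_funD => //.
  apply: measurable_sum => i; exact: measurable_funM.
have le d (T : measurableType d) (w : T -> R) (f : R) x :
  (forall x, (`|w x| <= C)%R) -> (`|f| <= 1)%R -> (`|w x * f| <= C)%R.
  by move=> wC f1; rewrite normrM -[leRHS]mulr1 ler_pM.
(* The indicator of the first coordinate joins the weight. What is left to check has a cosine of the
   other coordinates, which becomes the weight of a one-dimensional uniqueness problem in the
   first. *)
apply: (IH (fun i => Y1 (lift ord0 i)) (fun i => Y2 (lift ord0 i)) (fun i => A (lift ord0 i)) _ _ _ _ _ C) => //.
- by apply: measurable_funM => //; exact: measurable_indic_comp.
- by move=> x; apply: le => //; exact: indic_norm_le1.
- by apply: measurable_funM => //; exact: measurable_indic_comp.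
- by move=> x; apply: le => //; exact: indic_norm_le1.
move=> a c.
under eq_Rintegral do rewrite mulrAC.
under [RHS]eq_Rintegral do rewrite mulrAC.
apply: (@weighted_cos_unique _ (Y1 ord0) _ (Y2 ord0) C) => //.
- by apply: measurable_funM => //; exact: mcos.
- by move=> x; apply: le => //; exact: cos_max.
- by apply: measurable_funM => //; exact: mcos.
- by move=> x; apply: le => //; exact: cos_max.
move=> t b.
(* [oapp a t (unlift ord0 i)] is the coefficient vector with [t] in front of [a]; the product of the
   two cosines is a half-sum of cosines for the vectors headed by [t] and [- t]. *)
have E d (T : measurableType d) (P : probability T R) (w : T -> R) (Y : 'I_n.+1 -> T -> R) :
    measurable_fun setT w -> (forall x, (`|w x| <= C)%R) -> (forall i, measurable_fun setT (Y i)) ->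
    (\int[P]_x (w x * cos (\sum_(i < n) a i * Y (lift ord0 i) x + c) * cos (t * Y ord0 x + b)) =
     2^-1 * (\int[P]_x (w x * cos (\sum_(i < n.+1) oapp a t (unlift ord0 i) * Y i x + (c + b))) +
       \int[P]_x (w x * cos (\sum_(i < n.+1) oapp a (- t) (unlift ord0 i) * Y i x + (c - b)))))%R.
  move=> mw wC mY.
  have mcos' a' c' : measurable_fun setT (fun x => w x * cos (\sum_(i < n.+1) a' i * Y i x + c'))%R.
    apply: measurable_funM => //; apply: (measurableT_comp (f := @cos R)).
      by apply: continuous_measurable_fun; exact: continuous_cos.
    apply: measurable_funD => //.
    by apply: measurable_sum => i; exact: measurable_funM.
  have b' a' c' x : (`|w x * cos (\sum_(i < n.+1) a' i * Y i x + c')| <= C)%R.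
    by apply: le => //; exact: cos_max.
  rewrite -RintegralD//; last 2 first.
  - exact: (bounded_integrable P (mcos' _ _) (b' _ _)).
  - exact: (bounded_integrable P (mcos' _ _) (b' _ _)).
  rewrite -RintegralZl//; last first.
    apply: (bounded_integrable P (C := (C + C)%R)); first exact: measurable_funD.
    by move=> x; apply: (le_trans (ler_normD _ _)); exact: lerD.
  apply: eq_Rintegral => x _; rewrite -mulrA cosM -mulrDr mulrCA.
  have S u : (\sum_(i < n.+1) oapp a u (unlift ord0 i) * Y i x =
     \sum_(i < n) a i * Y (lift ord0 i) x + u * Y ord0 x)%R.
    rewrite big_ord_recl unlift_none /= addrC; congr (_ + _)%R.
    by apply: eq_bigr => i _; rewrite liftK.
  rewrite !S; congr (_ * (_ * (cos _ + cos _)))%R; first by rewrite addrACA.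
  by rewrite opprD mulNr addrACA.
by rewrite !E// !H.
Qed.

End characteristic_uniqueness.

(** * Gaussian vectors *)

Section gaussian_vector.
Context {R : realType} d (Omega : measurableType d) (P : probability Omega R).

Definition centered_L2 (f : Omega -> R) : Prop :=
  [/\ measurable_fun setT f, P.-integrable setT (fun w => (f w ^+ 2)%:E) &
      \int[P]_w (f w)%:E = 0].

Lemma integrable_mulL2 (f g : Omega -> R) :
  measurable_fun setT f -> P.-integrable setT (fun w => (f w ^+ 2)%:E) ->
  measurable_fun setT g -> P.-integrable setT (fun w => (g w ^+ 2)%:E) ->
  P.-integrable setT (fun w => (f w * g w)%:E).
Proof.
move=> mf f2 mg g2.
apply: (@le_integrable _ _ _ P setT measurableT _ (fun w => (f w ^+ 2)%:E + (g w ^+ 2)%:E)).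
- by apply/measurable_EFinP; exact: measurable_funM.
- move=> w _; rewrite -EFinD lee_fin [leRHS]ger0_norm ?addr_ge0 ?sqr_ge0//.
  rewrite normrM -(real_normK (num_real (f w))) -(real_normK (num_real (g w))).
  have := sqr_ge0 (`|f w| - `|g w|)%R; rewrite sqrrB.
  have := mulr_ge0 (normr_ge0 (f w)) (normr_ge0 (g w)).
  by move: (`|f w| * `|g w|)%R (`|f w| ^+ 2)%R (`|g w| ^+ 2)%R => x y z *; lra.
- exact: integrableD.
Qed.

Lemma integrable_L2 (f : Omega -> R) :
  measurable_fun setT f -> P.-integrable setT (fun w => (f w ^+ 2)%:E) ->
  P.-integrable setT (fun w => (f w)%:E).
Proof.
move=> mf f2.
have E : \int[P]_w (f w ^+ 2)%:E = (\int[P]_w f w ^+ 2)%R%:E.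
  by rewrite /Rintegral fineK//; exact: (integrable_fin_num measurableT f2).
by have [] := square_integrable_integrable mf E.
Qed.

Lemma Rintegral_sum n (f : 'I_n -> Omega -> R) :
  (forall i, P.-integrable setT (fun w => (f i w)%:E)) ->
  P.-integrable setT (fun w => (\sum_(i < n) f i w)%:E) /\
  (\int[P]_w (\sum_(i < n) f i w) = \sum_(i < n) \int[P]_w f i w)%R.
Proof.
elim: n f => [|n IH] f fi.
  split; first by under eq_fun do rewrite big_ord0; exact: integrable0.
  by under eq_Rintegral do rewrite big_ord0; rewrite big_ord0 /Rintegral integral0.
have [i1 E1] := IH (fun i => f (lift ord0 i)) (fun i => fi (lift ord0 i)).
split.
  by under eq_fun do rewrite big_ord_recl EFinD; exact: integrableD.
under eq_Rintegral do rewrite big_ord_recl.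
by rewrite big_ord_recl -E1 RintegralD//; exact: fi.
Qed.

Lemma centered_L2D (f g : Omega -> R) :
  centered_L2 f -> centered_L2 g -> centered_L2 (fun w => f w + g w)%R.
Proof.
move=> [mf f2 f0] [mg g2 g0]; split; first exact: measurable_funD.
- have fg := integrable_mulL2 mf f2 mg g2.
  under eq_fun do rewrite sqrrD -mulr_natl 2!EFinD.
  apply: integrableD => //; apply: integrableD => //.
  by under eq_fun do rewrite EFinM; apply: integrableZl.
- under eq_integral do rewrite EFinD.
  by rewrite integralD//; [rewrite f0 g0 adde0|exact: integrable_L2|exact: integrable_L2].
Qed.

Lemma centered_L2Z a (f : Omega -> R) :
  centered_L2 f -> centered_L2 (fun w => a * f w)%R.
Proof.
move=> [mf f2 f0]; split; first exact: measurable_funM.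
- under eq_fun do rewrite exprMn EFinM.
  by apply: integrableZl.
- under eq_integral do rewrite EFinM.
  by rewrite integralZl// ?f0 ?mule0//; exact: integrable_L2.
Qed.

Lemma centered_L2_sum n (a : 'I_n -> R) (f : 'I_n -> Omega -> R) :
  (forall i, centered_L2 (f i)) -> centered_L2 (fun w => \sum_(i < n) a i * f i w)%R.
Proof.
elim: n a f => [|n IH] a f cf.
  rewrite (_ : (fun w => _) = fun=> 0%R); last by apply/funext => w; rewrite big_ord0.
  split => //; last exact: integral0.
  by under eq_fun do rewrite expr0n/=; exact: integrable0.
rewrite (_ : (fun w => _) =
  fun w => (a ord0 * f ord0 w + \sum_(i < n) a (lift ord0 i) * f (lift ord0 i) w)%R); last first.
  by apply/funext => w; rewrite big_ord_recl.
apply: centered_L2D; first exact: centered_L2Z.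
by apply: IH => i; exact: cf.
Qed.

Lemma centered_normal_cos (L : Omega -> R) : normal_rv P L -> centered_L2 L ->
  forall c, (\int[P]_w cos (L w + c) = expR (- (\int[P]_w L w ^+ 2 / 2)) * cos c)%R.
Proof.
move=> nL [mL L2 L0]; apply: centered_normal_rv_cos => //.
by rewrite /Rintegral fineK//; exact: (integrable_fin_num measurableT L2).
Qed.

(** Still a linear combination of the [V i]: only the coefficient of [V j] changes, absorbing [t]
    and all the subtracted terms. *)
Lemma normal_rv_residual n (V : 'I_n -> Omega -> R) (j : 'I_n) (a r : 'I_n -> R) (t : R) :
  multivariate_normal P V ->
  normal_rv P (fun w => \sum_(i < n) a i * (V i w - r i * V j w) + t * V j w)%R.
Proof.
move=> gV.
have := gV (fun i => a i + (i == j)%:R * (t - \sum_(k < n) a k * r k))%R.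
congr normal_rv; apply/funext => w.
under eq_bigr do rewrite mulrDl.
have E u : (\sum_(i < n) (i == j)%:R * u * V i w = u * V j w)%R.
  rewrite (bigD1 j)//= eqxx mul1r big1 ?addr0// => i ij.
  by rewrite (negbTE ij) !mul0r.
rewrite big_split/= E.
under [in RHS]eq_bigr do rewrite mulrBr mulrA.
by rewrite sumrB -mulr_suml mulrBl; ring.
Qed.

(** The choice of [r], with [V j] of unit variance, makes every residual orthogonal to [V j]. The
    variance of the combination therefore splits into a sum, and its exponential into a product. *)
Lemma residual_cos n (V : 'I_n -> Omega -> R) (j : 'I_n) (r : 'I_n -> R) :
  multivariate_normal P V -> (forall i, centered_L2 (V i)) ->
  (\int[P]_w V j w ^+ 2 = 1)%R -> (forall i, r i = \int[P]_w (V i w * V j w))%R ->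
  forall a t c,
  (\int[P]_w cos (\sum_(i < n) a i * (V i w - r i * V j w) + t * V j w + c) =
   expR (- (\int[P]_w (\sum_(i < n) a i * (V i w - r i * V j w)) ^+ 2 / 2)) *
   expR (- (t ^+ 2 / 2)) * cos c)%R.
Proof.
move=> gV cV vj rE a t c.
pose S w := (\sum_(i < n) a i * (V i w - r i * V j w))%R.
have cS : centered_L2 S.
  apply: centered_L2_sum => i.
  under eq_fun do rewrite -mulNr.
  by apply: centered_L2D => //; exact: centered_L2Z.
have ctV := centered_L2Z t (cV j).
have [mS S2 S0] := cS; have [mV V2 V0] := cV j.
have SV : (\int[P]_w (S w * V j w) = 0)%R.
  have ij i : P.-integrable setT (fun w => (V i w * V j w)%:E).
    by have [mVi V2i _] := cV i; exact: integrable_mulL2.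
  have ij2 i : P.-integrable setT (fun w => (r i * V j w ^+ 2)%:E).
    by under eq_fun do rewrite EFinM; apply: integrableZl.
  have i2 i : P.-integrable setT (fun w => (V i w * V j w - r i * V j w ^+ 2)%:E).
    by under eq_fun do rewrite EFinB; exact: integrableB.
  have i3 i : P.-integrable setT (fun w => (a i * (V i w * V j w - r i * V j w ^+ 2))%:E).
    by under eq_fun do rewrite EFinM; apply: integrableZl.
  have -> : (fun w => S w * V j w)%R =
      (fun w => \sum_(i < n) a i * (V i w * V j w - r i * V j w ^+ 2))%R.
    apply/funext => w; rewrite /S mulr_suml; apply: eq_bigr => i _; ring.
  rewrite (Rintegral_sum i3).2 big1// => i _.
  rewrite RintegralZl//; last exact: i2.
  rewrite RintegralB//; [|exact: ij|exact: ij2].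
  rewrite RintegralZl//.
  by rewrite vj mulr1 -rE subrr mulr0.
rewrite (centered_normal_cos (normal_rv_residual j a r t gV)); last exact: centered_L2D.
congr (_ * _)%R; rewrite -expRD; congr expR.
rewrite -opprD -mulrDl; congr (- (_ / 2))%R.
have iSV := integrable_mulL2 mS S2 mV V2.
under eq_Rintegral do rewrite sqrrD exprMn mulrCA -mulrnAr.
have i2S : P.-integrable setT (fun w => (t * (S w * V j w *+ 2))%:E).
  under eq_fun do rewrite -mulr_natl mulrA EFinM.
  by apply: integrableZl.
have itV : P.-integrable setT (fun w => (t ^+ 2 * V j w ^+ 2)%:E).
  by under eq_fun do rewrite EFinM; apply: integrableZl.
have iS2S : P.-integrable setT (fun w => (S w ^+ 2 + t * (S w * V j w *+ 2))%:E).
  by under eq_fun do rewrite EFinD; exact: integrableD.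
rewrite RintegralD// RintegralD// [X in (_ + _ + X)%R]RintegralZl// vj mulr1.
congr (_ + _)%R; rewrite -[RHS]addr0; congr (_ + _)%R.
under eq_Rintegral do rewrite -mulr_natl mulrA.
by rewrite RintegralZl// SV mulr0.
Qed.

End gaussian_vector.

(** * Independence from factorised cosine integrals *)

Section gaussian_independence.
Context {R : realType} d (Omega : measurableType d) (P : probability Omega R).

Lemma prod_indicE (T : Type) n (W : 'I_n -> T -> R) (B : 'I_n -> set R) (x : T) :
  (\prod_(i < n) \1_(B i) (W i x) = \1_([set x | forall i, B i (W i x)]) x :> R)%R.
Proof.
have [H|H] := pselect (forall i, B i (W i x)).
  rewrite [RHS]indicE mem_set// big1// => i _.
  by rewrite indicE mem_set.
rewrite [RHS]indicE memNset//.
have [i nB] : exists i, ~ B i (W i x) by exact/existsNP.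
by rewrite (bigD1 i)//= indicE memNset// mul0r.
Qed.

Lemma measurable_rectangle d' (T : measurableType d') n (W : 'I_n -> T -> R) (B : 'I_n -> set R) :
  (forall i, measurable_fun setT (W i)) -> (forall i, measurable (B i)) ->
  measurable [set x | forall i, B i (W i x)].
Proof.
move=> mW mB.
rewrite (_ : [set x | _] = \bigcap_(i in [set: 'I_n]) (W i @^-1` B i)); last first.
  by apply/seteqP; split => [x H i _|x H i]; [exact: H|exact: H].
apply: fin_bigcap_measurable => // i _.
by rewrite -[X in measurable X]setTI; exact: mW.
Qed.

Lemma Rintegral_indic (A : set Omega) : measurable A ->
  (\int[P]_w \1_A w)%R = fine (P A).
Proof. by move=> mA; rewrite /Rintegral integral_indic// setIT. Qed.

(** Kac's criterion. [f] and [g] need not be characteristic functions; [f 0 * g 0 = 1] normalises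
    them enough. First the indicator of [Z] is replaced by its mean against cosines of [W]; then
    uniqueness in [W] is applied with that indicator as weight on one side and its mean on the
    other. *)
Lemma independent_of_cos n (Z : Omega -> R) (W : 'I_n -> Omega -> R)
    (f : ('I_n -> R) -> R) (g : R -> R) :
  measurable_fun setT Z -> (forall i, measurable_fun setT (W i)) ->
  (forall a t c, \int[P]_w cos (\sum_(i < n) a i * W i w + t * Z w + c) =
     f a * g t * cos c)%R ->
  forall A (B : 'I_n -> set R), measurable A -> (forall i, measurable (B i)) ->
  P (Z @^-1` A `&` [set w | forall i, B i (W i w)]) =
  P (Z @^-1` A) * P [set w | forall i, B i (W i w)].
Proof.
move=> mZ mW H A B mA mB.
have f0g0 : (f (fun=> 0) * g 0 = 1)%R.
  have := H (fun=> 0%R) 0%R 0%R; rewrite cos0 mulr1 => <-.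
  under eq_Rintegral.
    move=> w _; rewrite mul0r big1 ?addr0 ?cos0; last by move=> i _; rewrite mul0r.
    over.
  by rewrite /Rintegral integral_probability_cst.
have mS a : measurable_fun setT (fun w => \sum_(i < n) a i * W i w)%R.
  by apply: measurable_sum => i; exact: measurable_funM.
have mc : measurable_fun setT (@cos R).
  by apply: continuous_measurable_fun; exact: continuous_cos.
have mcos a c : measurable_fun setT (fun w => cos (\sum_(i < n) a i * W i w + c))%R.
  by apply: measurableT_comp => //; exact: measurable_funD.
have HS a c : (\int[P]_w cos (\sum_(i < n) a i * W i w + c) = f a * g 0 * cos c)%R.
  rewrite -H; apply: eq_Rintegral => w _; by rewrite mul0r addr0.
have HZ t c : (\int[P]_w cos (t * Z w + c) = f (fun=> 0) * g t * cos c)%R.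
  rewrite -H; apply: eq_Rintegral => w _; rewrite big1 ?add0r// => i _.
  by rewrite mul0r.
have mA' : measurable (Z @^-1` A) by rewrite -[X in measurable X]setTI; exact: mZ.
have iA : (fun w => \1_A (Z w) : R) = \1_(Z @^-1` A) by [].
(* The product-to-sum formula produces both [t] and [- t]; evenness of [cos] lets the two terms
   recombine. *)
have gN t : g (- t)%R = g t.
  have f00 : (f (fun=> 0) != 0)%R.
    by apply/eqP => e; move: f0g0; rewrite e mul0r => /eqP; rewrite eq_sym oner_eq0.
  apply: (mulfI f00); have := HZ (- t)%R 0%R; have := HZ t 0%R.
  rewrite cos0 !mulr1 => <- <-; apply: eq_Rintegral => w _.
  by rewrite !addr0 mulNr cosN.
(* One-dimensional uniqueness in [Z], comparing the weight [cos (<a, W> + c)] with its constant mean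
   [K]. *)
have E1 a c : (\int[P]_w (\1_A (Z w) * cos (\sum_(i < n) a i * W i w + c)) =
    \int[P]_w (fine (P (Z @^-1` A)) * cos (\sum_(i < n) a i * W i w + c)))%R.
  pose K := (f a * g 0 * cos c)%R.
  have := @weighted_cos_unique _ _ _ _ _ P P
    (fun w => cos (\sum_(i < n) a i * W i w + c))%R Z (fun=> K) Z (`|K| + 1)%R
    (mcos _ _) _ mZ (measurable_cst _) _ mZ _ A mA.
  under eq_Rintegral do rewrite mulrC.
  move=> ->.
  - rewrite RintegralZl//; last first.
      by apply: (bounded_integrable P (C := 1%R) (measurable_indic_comp mZ mA)) => w; exact: indic_norm_le1.
    rewrite RintegralZl//; last first.
      by apply: (bounded_integrable P (C := 1%R) (mcos _ _)) => w; exact: cos_max.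
    by rewrite HS iA Rintegral_indic// mulrC.
  - by move=> w; rewrite (le_trans (cos_max _))// lerDr.
  - by move=> w; rewrite lerDl.
  - move=> t b.
    rewrite RintegralZl//; last first.
      apply: (bounded_integrable P (C := 1%R)) => [|w]; last exact: cos_max.
      by apply: measurableT_comp => //; apply: measurable_funD => //; exact: measurable_funM.
    transitivity (\int[P]_w (2^-1 * (cos (\sum_(i < n) a i * W i w + t * Z w + (c + b)) +
        cos (\sum_(i < n) a i * W i w + - t * Z w + (c - b)))))%R.
      apply: eq_Rintegral => w _; rewrite cosM; congr (_ * (cos _ + cos _))%R; ring.
    have mcos' t' c' : measurable_fun setT (fun w => cos (\sum_(i < n) a i * W i w + t' * Z w + c'))%R.
      apply: measurableT_comp => //; apply: measurable_funD => //.
      by apply: measurable_funD => //; exact: measurable_funM.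
    have icos t' c' : P.-integrable setT (EFin \o (fun w => cos (\sum_(i < n) a i * W i w + t' * Z w + c')))%R.
      by apply: (bounded_integrable P (C := 1%R) (mcos' _ _)) => w; exact: cos_max.
    rewrite RintegralZl//; last first.
      exact: (integrableD measurableT (icos t (c + b)%R) (icos (- t)%R (c - b)%R)).
    rewrite RintegralD//.
    rewrite !H HZ gN /K.
    have -> : (f a * g 0 * cos c * (f (fun=> 0) * g t * cos b) =
      (f (fun=> 0) * g 0) * (f a * g t * (cos c * cos b)))%R by ring.
    by rewrite f0g0 cosM; ring.
have := @weighted_vector_unique R _ _ _ _ P P n W W B mW mW mB (fun w => \1_A (Z w))
  (fun=> fine (P (Z @^-1` A))) 1%R (measurable_indic_comp mZ mA) _ (measurable_cst _) _ E1.
have mr := measurable_rectangle mW mB.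
have irect : P.-integrable setT (EFin \o (fun w => \prod_(i < n) \1_(B i) (W i w)))%R.
  rewrite (_ : _ \o _ = fun w => (\1_[set x | forall i, B i (W i x)] w)%:E).
    exact: integrable_indic.
  by apply/funext => w /=; rewrite prod_indicE.
have pA : (`|fine (P (Z @^-1` A))| <= 1)%R.
  rewrite ger0_norm; last by apply: fine_ge0; exact: measure_ge0.
  by rewrite -lee_fin fineK; [exact: probability_le1|exact: fin_num_measure].
rewrite RintegralZl// => E.
have mZB : measurable (Z @^-1` A `&` [set w | forall i, B i (W i w)]) by exact: measurableI.
have e (S : set Omega) : measurable S -> P S \is a fin_num by move=> mS'; exact: fin_num_measure.
rewrite -(fineK (e _ mZB)) -(fineK (e _ mA')) -(fineK (e _ mr)) -EFinM; congr EFin.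
rewrite -(Rintegral_indic mr) -(Rintegral_indic mZB).
under [in RHS]eq_Rintegral do rewrite -prod_indicE.
rewrite -E => [| |]; last 2 first.
- by move=> w; exact: indic_norm_le1.
- by [].
by apply: eq_Rintegral => w _; rewrite indicI prod_indicE.
Qed.

End gaussian_independence.

(** * Rotation invariance of two independent copies *)

Section rotation.
Context {R : realType}.

Lemma measurable_cos_sum d (T : measurableType d) n (Y : 'I_n -> T -> R) (a : 'I_n -> R) (c : R) :
  (forall i, measurable_fun setT (Y i)) ->
  measurable_fun setT (fun x => cos (\sum_(i < n) a i * Y i x + c))%R.
Proof.
move=> mY; apply: (measurableT_comp (f := @cos R)).
  by apply: continuous_measurable_fun; exact: continuous_cos.
apply: measurable_funD => //.
by apply: measurable_sum => i; exact: measurable_funM.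
Qed.

(** Two passes of the vector uniqueness: the first vector is resolved with a cosine of the second as
    weight, then the second vector with the product of indicators so obtained as weight. *)
Lemma two_vector_unique d1 d2 (T1 : measurableType d1) (T2 : measurableType d2)
    (P1 : probability T1 R) (P2 : probability T2 R) n
    (Y1 Z1 : 'I_n -> T1 -> R) (Y2 Z2 : 'I_n -> T2 -> R) (A B : 'I_n -> set R) :
  (forall i, measurable_fun setT (Y1 i)) -> (forall i, measurable_fun setT (Z1 i)) ->
  (forall i, measurable_fun setT (Y2 i)) -> (forall i, measurable_fun setT (Z2 i)) ->
  (forall i, measurable (A i)) -> (forall i, measurable (B i)) ->
  (forall a b c,
    \int[P1]_x cos (\sum_(i < n) a i * Y1 i x + \sum_(i < n) b i * Z1 i x + c) =
    \int[P2]_x cos (\sum_(i < n) a i * Y2 i x + \sum_(i < n) b i * Z2 i x + c))%R ->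
  P1 ([set x | forall i, A i (Y1 i x)] `&` [set x | forall i, B i (Z1 i x)]) =
  P2 ([set x | forall i, A i (Y2 i x)] `&` [set x | forall i, B i (Z2 i x)]).
Proof.
move=> mY1 mZ1 mY2 mZ2 mA mB H.
have mprod d (T : measurableType d) (Y : 'I_n -> T -> R) : (forall i, measurable_fun setT (Y i)) ->
    measurable_fun setT (fun x => \prod_(i < n) \1_(A i) (Y i x) : R)%R.
  move=> mY; under eq_fun do rewrite prod_indicE.
  by apply: measurable_indic; exact: measurable_rectangle.
have bprod (T : Type) (Y : 'I_n -> T -> R) x : (`|\prod_(i < n) \1_(A i) (Y i x) : R| <= 1)%R.
  by rewrite prod_indicE; exact: indic_norm_le1.
have E1 b c : (\int[P1]_x (\prod_(i < n) \1_(A i) (Y1 i x) * cos (\sum_(i < n) b i * Z1 i x + c)) =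
    \int[P2]_x (\prod_(i < n) \1_(A i) (Y2 i x) * cos (\sum_(i < n) b i * Z2 i x + c)))%R.
  under eq_Rintegral do rewrite mulrC.
  under [RHS]eq_Rintegral do rewrite mulrC.
  apply: (@weighted_vector_unique R _ _ _ _ P1 P2 n Y1 Y2 A mY1 mY2 mA _ _ 1%R) => //.
  - exact: measurable_cos_sum.
  - by move=> x; exact: cos_max.
  - exact: measurable_cos_sum.
  - by move=> x; exact: cos_max.
  move=> a c'.
  have S d (T : measurableType d) (P : probability T R) (Y Z : 'I_n -> T -> R) :
      (forall i, measurable_fun setT (Y i)) -> (forall i, measurable_fun setT (Z i)) ->
      (\int[P]_x (cos (\sum_(i < n) b i * Z i x + c) * cos (\sum_(i < n) a i * Y i x + c')) =
       2^-1 * (\int[P]_x cos (\sum_(i < n) a i * Y i x + \sum_(i < n) b i * Z i x + (c + c')) +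
        \int[P]_x cos (\sum_(i < n) (- a i) * Y i x + \sum_(i < n) b i * Z i x + (c - c'))))%R.
    move=> mY mZ.
    have ic a' e : P.-integrable setT (EFin \o (fun x =>
        cos (\sum_(i < n) a' i * Y i x + \sum_(i < n) b i * Z i x + e)))%R.
      apply: (bounded_integrable P (C := 1%R)) => [|x]; last exact: cos_max.
      apply: (measurableT_comp (f := @cos R)).
        by apply: continuous_measurable_fun; exact: continuous_cos.
      apply: measurable_funD => //; apply: measurable_funD.
        by apply: measurable_sum => i; exact: measurable_funM.
      by apply: measurable_sum => i; exact: measurable_funM.
    rewrite -RintegralD//.
    rewrite -RintegralZl//; last first.
      exact: (integrableD measurableT (ic a (c + c')%R) (ic (fun i => - a i)%R (c - c')%R)).
    apply: eq_Rintegral => x _; rewrite cosM; congr (_ * (cos _ + cos _))%R.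
      by ring.
    under [in RHS]eq_bigr do rewrite mulNr.
    by rewrite sumrN; ring.
  by rewrite !S// !H.
have := @weighted_vector_unique R _ _ _ _ P1 P2 n Z1 Z2 B mZ1 mZ2 mB _ _ 1%R
  (mprod _ _ _ mY1) (bprod _ _) (mprod _ _ _ mY2) (bprod _ _) E1.
have toP d (T : measurableType d) (P : probability T R) (Y Z : 'I_n -> T -> R) :
    (forall i, measurable_fun setT (Y i)) -> (forall i, measurable_fun setT (Z i)) ->
   (\int[P]_x (\prod_(i < n) \1_(A i) (Y i x) * \prod_(i < n) \1_(B i) (Z i x)))%R%:E =
   P ([set x | forall i, A i (Y i x)] `&` [set x | forall i, B i (Z i x)]).
  move=> mY mZ.
  have mr1 := measurable_rectangle mY mA.
  have mr2 := measurable_rectangle mZ mB.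
  have mr := measurableI _ _ mr1 mr2.
  under eq_Rintegral do rewrite !prod_indicE.
  rewrite (_ : (fun w => _) = (\1_([set x | forall i, A i (Y i x)] `&` [set x | forall i, B i (Z i x)]) : T -> R)); last first.
    by apply/funext => w; rewrite indicI.
  by rewrite Rintegral_indic// fineK// fin_num_measure.
by move=> E; rewrite -!toP// E.
Qed.

Context d (Omega : measurableType d) (P : probability Omega R).

Lemma product_cos (L L' : Omega -> R) : normal_rv P L -> centered_L2 P L ->
  normal_rv P L' -> centered_L2 P L' -> forall c,
  (\int[P \x P]_z cos (L z.1 + L' z.2 + c) =
   expR (- ((\int[P]_w L w ^+ 2 + \int[P]_w L' w ^+ 2) / 2)) * cos c)%R.
Proof.
move=> nL cL nL' cL' c; have [mL _ _] := cL; have [mL' _ _] := cL'.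
have mcos : measurable_fun setT (@cos R).
  by apply: continuous_measurable_fun; exact: continuous_cos.
rewrite -(@bounded_Fubini1 _ _ _ _ _ P P (fun z => cos (L z.1 + L' z.2 + c))%R 1%R); last 2 first.
- apply: measurableT_comp => //; apply: measurable_funD => //.
  by apply: measurable_funD; exact: measurableT_comp.
- by move=> z; exact: cos_max.
under eq_Rintegral.
  move=> x _; rewrite /=; under eq_Rintegral do rewrite [(L x + _)%R]addrC -addrA.
  rewrite (centered_normal_cos nL' cL').
  over.
rewrite /= RintegralZl//; last first.
  apply: (bounded_integrable P (C := 1%R)) => [|x]; last exact: cos_max.
  by apply: measurableT_comp => //; exact: measurable_funD.
rewrite (centered_normal_cos nL cL) mulrA -expRD; congr (expR _ * _)%R.
by ring.
Qed.

(** On the product space the cosine integrals depend only on the sum of two second moments, and the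
    rotation preserves that sum by the parallelogram identity, as [r ^+ 2 = 1 / 2]. *)
Lemma gaussian_rotation n (V : 'I_n -> Omega -> R) (A B : 'I_n -> set R) :
  multivariate_normal P V -> (forall i, centered_L2 P (V i)) ->
  (forall i, measurable (A i)) -> (forall i, measurable (B i)) ->
  let r := ((Num.sqrt 2)^-1)%R in
  (P \x P) ([set z | forall i, A i (r * (V i z.1 + V i z.2))%R] `&`
            [set z | forall i, B i (r * (V i z.1 - V i z.2))%R]) =
  P [set w | forall i, A i (V i w)] * P [set w | forall i, B i (V i w)].
Proof.
move=> gV cV mA mB r.
have r2 : (r ^+ 2 = 2^-1)%R by rewrite exprVn sqr_sqrtr.
have mV i : measurable_fun setT (V i) by case: (cV i).
have mV1 i : measurable_fun setT (fun z : Omega * Omega => V i z.1) by exact: measurableT_comp.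
have mV2 i : measurable_fun setT (fun z : Omega * Omega => V i z.2) by exact: measurableT_comp.
rewrite (@two_vector_unique _ _ _ _ (P \x P) (P \x P) n
  (fun i z => r * (V i z.1 + V i z.2))%R (fun i z => r * (V i z.1 - V i z.2))%R
  (fun i z => V i z.1) (fun i z => V i z.2) A B) //.
- rewrite (_ : _ `&` _ = [set w | forall i, A i (V i w)] `*` [set w | forall i, B i (V i w)]).
    by apply: product_measure1E; exact: measurable_rectangle.
  by apply/seteqP; split.
- by move=> i; apply: measurable_funM => //; exact: measurable_funD.
- by move=> i; apply: measurable_funM => //; exact: measurable_funB.
move=> a b c.
pose S (a' : 'I_n -> R) w := (\sum_(i < n) a' i * V i w)%R.
have cS a' : centered_L2 P (S a') by exact: centered_L2_sum.
rewrite (product_cos (gV a) (cS a) (gV b) (cS b)).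
transitivity (\int[P \x P]_z cos (S (fun i => r * (a i + b i)) z.1 + S (fun i => r * (a i - b i)) z.2 + c))%R.
  apply: eq_Rintegral => z _; congr (cos (_ + _))%R.
  rewrite /S -!big_split/=; apply: eq_bigr => i _; ring.
rewrite (product_cos (gV _) (cS _) (gV _) (cS _)); congr (expR (- (_ / 2)) * _)%R.
have i2 a' : P.-integrable setT (fun w => (S a' w ^+ 2)%:E) by case: (cS a').
rewrite -RintegralD//; [|exact: i2|exact: i2]; rewrite -RintegralD//; [|exact: i2|exact: i2].
apply: eq_Rintegral => w _.
change (S (fun i => r * (a i + b i)) w ^+ 2 + S (fun i => r * (a i - b i)) w ^+ 2 = S a w ^+ 2 + S b w ^+ 2)%R.
have -> : S (fun i => r * (a i + b i))%R w = (r * (S a w + S b w))%R.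
  by rewrite /S -big_split/= mulr_sumr; apply: eq_bigr => i _; ring.
have -> : S (fun i => r * (a i - b i))%R w = (r * (S a w - S b w))%R.
  by rewrite /S -sumrB mulr_sumr; apply: eq_bigr => i _; ring.
by rewrite !exprMn r2; field.
Qed.

End rotation.

(** * Integrability of the supremum *)

Section fernique.
Context {R : realType} d (Omega : measurableType d) (P : probability Omega R).

Let fin (S : set Omega) : measurable S -> P S \is a fin_num.
Proof. by move=> mS; exact: fin_num_measure. Qed.

Let ball_le (u : R) : set R := [set x | (`|x| <= u)%R].

Let measurable_ball_le u : measurable (ball_le u).
Proof.
rewrite (_ : ball_le u = `[(- u)%R, u]%classic); first exact: measurable_itv.
by apply/seteqP; split => x; rewrite /ball_le /= in_itv/= ler_norml.
Qed.

Definition prob_sup_le n (V : 'I_n -> Omega -> R) (u : R) : R :=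
  fine (P [set w | forall i, (`|V i w| <= u)%R]).

Lemma prob_sup_le_le n (V : 'I_n -> Omega -> R) (u v : R) :
  (forall i, measurable_fun setT (V i)) -> (u <= v)%R ->
  (prob_sup_le V u <= prob_sup_le V v)%R.
Proof.
move=> mV uv.
have mS x : measurable [set w | forall i, (`|V i w| <= x)%R].
  exact: (measurable_rectangle mV (fun=> measurable_ball_le x)).
rewrite /prob_sup_le fine_le ?fin// le_measure ?inE//.
by move=> w /= H i; exact: le_trans (H i) uv.
Qed.

(* If [V] and [V'] are independent copies then so are [(V + V') / sqrt 2] and
   [(V - V') / sqrt 2], and both are large as soon as [V] is large and [V'] small. *)
Lemma fernique_step n (V : 'I_n -> Omega -> R) (s t : R) :
  multivariate_normal P V -> (forall i, centered_L2 P (V i)) ->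
  (prob_sup_le V s * (1 - prob_sup_le V t) <=
   (1 - prob_sup_le V ((t - s) / Num.sqrt 2)) ^+ 2)%R.
Proof.
move=> gV cV; set u := ((t - s) / _)%R.
have mV i : measurable_fun setT (V i) by case: (cV i).
have mS x : measurable [set w | forall i, (`|V i w| <= x)%R].
  exact: (measurable_rectangle mV (fun=> measurable_ball_le x)).
pose r : R := (Num.sqrt 2)^-1%R.
have r0 : (0 < r)%R by rewrite invr_gt0 sqrtr_gt0.
pose U : set (Omega * Omega) := [set z | forall i, ball_le u (r * (V i z.1 + V i z.2))%R].
pose D : set (Omega * Omega) := [set z | forall i, ball_le u (r * (V i z.1 - V i z.2))%R].
pose PP : probability (Omega * Omega)%type R := (P \x P)%E.
have mV1 i : measurable_fun setT (fun z : Omega * Omega => V i z.1) by exact: measurableT_comp.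
have mV2 i : measurable_fun setT (fun z : Omega * Omega => V i z.2) by exact: measurableT_comp.
have mU : measurable U.
  apply: (@measurable_rectangle _ _ _ _ (fun i z => r * (V i z.1 + V i z.2))%R (fun=> ball_le u)) => // i.
  by apply: measurable_funM => //; exact: measurable_funD.
have mD : measurable D.
  apply: (@measurable_rectangle _ _ _ _ (fun i z => r * (V i z.1 - V i z.2))%R (fun=> ball_le u)) => // i.
  by apply: measurable_funM => //; exact: measurable_funB.
have mB := measurable_ball_le u.
have finPP (S : set (Omega * Omega)) : measurable S -> PP S \is a fin_num.
  by move=> mS'; exact: fin_num_measure.
have UD : fine (PP (U `&` D)) = (prob_sup_le V u ^+ 2)%R.
  have := gaussian_rotation gV cV (fun=> mB) (fun=> mB) => /= E.
  by rewrite /PP /= /U /D /r E fineM ?(fin (mS u))//.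
(* Full lines in place of the other rectangle extract the marginal from the rotation identity;
   likewise for [PD]. *)
have PU : fine (PP U) = prob_sup_le V u.
  have := gaussian_rotation gV cV (fun=> mB) (fun=> measurableT) => /=.
  rewrite [X in _ `&` X](_ : _ = setT); last by apply/seteqP; split.
  rewrite [X in _ * P X](_ : _ = setT); last by apply/seteqP; split.
  by rewrite setIT probability_setT mule1 => E; rewrite /PP /= /U /r E.
have PD : fine (PP D) = prob_sup_le V u.
  have := gaussian_rotation gV cV (fun=> measurableT) (fun=> mB) => /=.
  rewrite [X in X `&` _](_ : _ = setT); last by apply/seteqP; split.
  rewrite [X in P X * _](_ : _ = setT); last by apply/seteqP; split.
  by rewrite setTI probability_setT mul1e => E; rewrite /PP /= /D /r E.
have compl (S : set (Omega * Omega)) : measurable S -> (fine (PP (~` S)) = 1 - fine (PP S))%R.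
  move=> mS'; have -> : PP (~` S) = 1 - PP S by exact: probability_setC.
  by have := fineK (finPP _ mS'); set x := PP S => <-.
(* Inclusion-exclusion: [U] and [D] have the same probability [p] and meet with probability
   [p ^+ 2]. *)
have -> : ((1 - prob_sup_le V u) ^+ 2 = fine (PP (~` U `&` ~` D)))%R.
  rewrite -setCU compl; last exact: measurableU.
  have -> : fine (PP (U `|` D)) = (fine (PP U) + fine (PP D) - fine (PP (U `&` D)))%R.
    have -> : PP (U `|` D) = PP U + PP D - PP (U `&` D).
      by apply: measureUfinr => //; rewrite ltey_eq finPP.
    rewrite fineB; [|by rewrite fin_numD !finPP|by apply: finPP; exact: measurableI].
    by rewrite fineD ?finPP.
  by rewrite PU PD UD; ring.
have -> : (prob_sup_le V s * (1 - prob_sup_le V t) =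
    fine (PP ((~` [set w | forall i, (`|V i w| <= t)%R]) `*` [set w | forall i, (`|V i w| <= s)%R])))%R.
  have -> : PP ((~` [set w | forall i, (`|V i w| <= t)%R]) `*` [set w | forall i, (`|V i w| <= s)%R]) =
      P (~` [set w | forall i, (`|V i w| <= t)%R]) * P [set w | forall i, (`|V i w| <= s)%R].
    by apply: product_measure1E => //; exact: measurableC.
  rewrite fineM ?fin//; last exact: measurableC.
  rewrite mulrC probability_setC// /prob_sup_le.
  by have := fineK (fin (mS t)); set x := P _ => <-.
apply: fine_le; rewrite ?finPP//.
- by apply: measurableX => //; exact: measurableC.
- by apply: measurableI; exact: measurableC.
apply: le_measure; rewrite ?inE//.
- by apply: measurableX => //; exact: measurableC.
- by apply: measurableI; exact: measurableC.
move=> [w1 w2] /= [/existsNP[i /negP]]; rewrite -ltNge => ti si.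
(* The same index serves both events: [|V i w1| > t] and [|V i w2| <= s] put the sum and the
   difference beyond [t - s]. *)
have H := si i.
split; apply/existsNP; exists i; apply/negP; rewrite -ltNge normrM (gtr0_norm r0).
- rewrite /u mulrC ltr_pM2l//.
  have := ler_normB (V i w1 + V i w2)%R (V i w2); rewrite addrK; lra.
- rewrite /u mulrC ltr_pM2l//.
  have := ler_normD (V i w1 - V i w2)%R (V i w2); rewrite subrK; lra.
Qed.

(** The recursion squares the tail at each step, but a geometric rate is enough: levels grow like
    [4 ^ k], so tails of order [8 ^ - k] make the expectation series converge. *)
Lemma fernique_tail n (V : 'I_n -> Omega -> R) (s : R) :
  multivariate_normal P V -> (forall i, centered_L2 P (V i)) -> (0 < s)%R ->
  (15 / 16 <= prob_sup_le V s)%R ->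
  forall k, (1 - prob_sup_le V (s * 4 ^+ k) <= 8^-1 ^+ k / 16)%R.
Proof.
move=> gV cV s0 a0.
have mV i : measurable_fun setT (V i) by case: (cV i).
have mS x : measurable [set w | forall i, (`|V i w| <= x)%R].
  exact: (measurable_rectangle mV (fun=> measurable_ball_le x)).
have le1 u : (prob_sup_le V u <= 1)%R.
  by rewrite /prob_sup_le -lee_fin fineK ?fin//; exact: probability_le1.
elim=> [|k IH]; first by rewrite !expr0 mulr1; lra.
have k1 : (1 <= 4 ^+ k :> R)%R by rewrite exprn_ege1//; lra.
have sq2 : (0 < Num.sqrt 2 :> R)%R by rewrite sqrtr_gt0.
have sq2' : (Num.sqrt 2 <= 2 :> R)%R.
  rewrite -[leRHS]ger0_norm// -sqrtr_sqr ler_wsqrtr// expr2; lra.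
have H := fernique_step s (s * 4 ^+ k.+1)%R gV cV.
(* [4 ^ (k + 1) - 1 >= 3 * 4 ^ k], more than the [2 * 4 ^ k] needed since [sqrt 2 <= 2]. *)
have arg : (s * 4 ^+ k <= (s * 4 ^+ k.+1 - s) / Num.sqrt 2)%R.
  rewrite ler_pdivlMr//.
  have : (s * 4 ^+ k * Num.sqrt 2 <= s * 4 ^+ k * 2)%R.
    by rewrite ler_wpM2l// mulr_ge0// ltW// exprn_gt0.
  rewrite exprS; have : (s <= s * 4 ^+ k)%R by rewrite ler_peMr// ltW.
  lra.
have M := prob_sup_le_le mV arg.
set b := (1 - prob_sup_le V (s * 4 ^+ k))%R in IH.
set b' := (1 - prob_sup_le V (s * 4 ^+ k.+1))%R in H *.
have b0 : (0 <= b)%R by rewrite subr_ge0.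
have b'0 : (0 <= b')%R by rewrite subr_ge0.
have H2 : (15 / 16 * b' <= b ^+ 2)%R.
  apply: le_trans (ler_wpM2r b'0 a0) _; apply: (le_trans H).
  by rewrite lerXn2r ?nnegrE ?subr_ge0// lerB.
have e0 : (0 < 8^-1 ^+ k :> R)%R by rewrite exprn_gt0.
have e1 : (8^-1 ^+ k <= 1 :> R)%R by rewrite exprn_ile1//; lra.
(* One factor [b] is bounded by [1 / 16] only. After division by [15 / 16] the gain is [1 / 15],
   which beats the required [1 / 8]. *)
have bb : (b ^+ 2 <= 16^-1 * (8^-1 ^+ k / 16))%R.
  rewrite expr2; apply: ler_pM => //; lra.
rewrite exprS; lra.
Qed.

(** The cosine integrals of centred combinations involve only second moments, unchanged by a sign.
    The zero family fills the second slot of [two_vector_unique]. *)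
Lemma gaussian_symmetric n (V : 'I_n -> Omega -> R) (A : 'I_n -> set R) :
  multivariate_normal P V -> (forall i, centered_L2 P (V i)) ->
  (forall i, measurable (A i)) ->
  P [set w | forall i, A i (- V i w)%R] = P [set w | forall i, A i (V i w)].
Proof.
move=> gV cV mA.
have mV i : measurable_fun setT (V i) by case: (cV i).
have T : [set w : Omega | forall i : 'I_n, [set: R] ((fun (_ : 'I_n) (_ : Omega) => 0%R) i w)] = setT.
  by apply/seteqP; split.
have z (b : 'I_n -> R) : (\sum_(i < n) b i * 0 = 0 :> R)%R.
  by rewrite big1// => i _; rewrite mulr0.
have S a w : (\sum_(i < n) a i * - V i w = \sum_(i < n) (- a i) * V i w)%R.
  by apply: eq_bigr => i _; rewrite mulrN mulNr.
have E a (b : 'I_n -> R) c : (\int[P]_w cos (\sum_(i < n) a i * - V i w + \sum_(i < n) b i * 0 + c) =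
    \int[P]_w cos (\sum_(i < n) a i * V i w + \sum_(i < n) b i * 0 + c))%R.
  under eq_Rintegral do rewrite z addr0 S.
  under [RHS]eq_Rintegral do rewrite z addr0.
  rewrite (centered_normal_cos (gV (fun i => - a i)%R) (centered_L2_sum (fun i => - a i)%R cV)).
  rewrite (centered_normal_cos (gV a) (centered_L2_sum a cV)).
  congr (expR (- (_ / 2)) * _)%R; apply: eq_Rintegral => w _.
  by rewrite -S; under eq_bigr do rewrite mulrN; rewrite sumrN sqrrN.
have := @two_vector_unique R _ _ _ _ P P n (fun i w => - V i w)%R (fun _ _ => 0%R) V (fun _ _ => 0%R)
  A (fun=> setT) (fun i => measurableT_comp _ (mV i)) (fun=> measurable_cst _) mV
  (fun=> measurable_cst _) mA (fun=> measurableT) E.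
by rewrite T !setIT; apply.
Qed.

(** Symmetry gives the lower tail the same bound as the upper one, so the exceptional probability at
    most doubles. This turns the one-sided [31 / 32] into the [15 / 16] that starts the tail
    recursion. *)
Lemma prob_sup_abs_ge n (V : 'I_n -> Omega -> R) (s e : R) :
  multivariate_normal P V -> (forall i, centered_L2 P (V i)) ->
  (1 - e <= fine (P [set w | forall i, (V i w <= s)%R]))%R ->
  (1 - 2 * e <= prob_sup_le V s)%R.
Proof.
move=> gV cV H.
have mV i : measurable_fun setT (V i) by case: (cV i).
pose A := [set w | forall i, (V i w <= s)%R].
pose B := [set w | forall i, (- V i w <= s)%R].
have mI : measurable ([set x : R | x <= s]%R).
  rewrite (_ : [set x | _] = `]-oo, s]%classic); first exact: measurable_itv.
  by apply/seteqP; split => x /=; rewrite in_itv/=.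
have mA : measurable A by exact: (measurable_rectangle mV (fun=> mI)).
have mB : measurable B.
  apply: (@measurable_rectangle _ _ _ _ (fun i w => - V i w)%R (fun=> [set x | (x <= s)%R])) => // i.
  exact: measurableT_comp.
have PB : P B = P A by exact: (gaussian_symmetric gV cV (fun=> mI)).
have -> : prob_sup_le V s = fine (P (A `&` B)).
  rewrite /prob_sup_le; congr (fine (P _)); apply/seteqP; split => [w /= Hw|w [/= HA HB] i].
    by split => i; have := Hw i; rewrite ler_norml => /andP[? ?]; lra.
  by rewrite ler_norml HA andbT; have := HB i; lra.
have U : P (A `|` B) = P A + P B - P (A `&` B).
  by apply: measureUfinr => //; rewrite ltey_eq fin.
have mAB : measurable (A `&` B) by exact: measurableI.
have U1 : (fine (P (A `|` B)) <= 1)%R.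
  rewrite -lee_fin fineK; first by apply: probability_le1; exact: measurableU.
  by apply: fin; exact: measurableU.
have : fine (P (A `|` B)) = (fine (P A) + fine (P A) - fine (P (A `&` B)))%R.
  rewrite U PB fineB; [|by rewrite fin_numD !fin|exact: fin].
  by rewrite fineD ?fin.
by move: H; rewrite -/A; lra.
Qed.

Definition seq_sup (f : nat -> Omega -> R) (w : Omega) : \bar R :=
  ereal_sup (range (fun k => (f k w)%:E)).

Lemma measurable_seq_sup (f : nat -> Omega -> R) :
  (forall k, measurable_fun setT (f k)) -> measurable_fun setT (seq_sup f).
Proof.
move=> mf; have := @measurable_fun_esups _ _ _ setT (fun k w => (f k w)%:E) _ 0%N.
rewrite (_ : (fun w => _) = seq_sup f); last first.
  apply/funext => w; rewrite /esups /seq_sup; congr ereal_sup.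
  by apply/seteqP; split => _ [k _ <-]; exists k.
by apply => k; exact/measurable_EFinP.
Qed.

Lemma seq_sup_gtP (f : nat -> Omega -> R) (w : Omega) (u : R) :
  u%:E < seq_sup f w <-> exists k, (u < f k w)%R.
Proof.
split=> [/ereal_sup_gt[_ [k _ <-]]|[k uk]]; first by rewrite lte_fin; exists k.
apply: (@lt_le_trans _ _ (f k w)%:E); first by rewrite lte_fin.
by apply: ereal_sup_ubound; exists k.
Qed.

(** Truncating at the levels [s * 4 ^ N] avoids assuming any integrability: each new truncation adds
    at most the next level on the event of exceeding the current one, and monotone convergence
    concludes with the bound [9 * s]. *)
Lemma gaussian_sup_abs_integrable (X : nat -> Omega -> R) (s : R) :
  (forall n, multivariate_normal P (fun i : 'I_n => X i)) ->
  (forall k, centered_L2 P (X k)) -> (0 < s)%R ->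
  (forall n, 31 / 32 <= fine (P [set w | forall i : 'I_n, X i w <= s]))%R ->
  \int[P]_w seq_sup (fun k w => `|X k w|%R) w < +oo.
Proof.
move=> gX cX s0 Hs.
have mX k : measurable_fun setT (X k) by case: (cX k).
have mabs k : measurable_fun setT (fun w => `|X k w|%R).
  by apply: (measurableT_comp (@normr_measurable R setT)).
pose f := seq_sup (fun k w => `|X k w|%R).
have mf : measurable_fun setT f by exact: measurable_seq_sup.
have f0 w : 0 <= f w.
  apply: (@le_trans _ _ (`|X 0%N w|%R)%:E); first by rewrite lee_fin.
  by apply: ereal_sup_ubound; exists 0%N.
pose F (u : R) := [set w | u%:E < f w].
have mF u : measurable (F u).
  rewrite (_ : F u = f @^-1` `]u%:E, +oo[%classic); last first.
    by apply/seteqP; split => w /=; rewrite /F /= in_itv/= andbT.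
  by rewrite -[X in measurable X]setTI; apply: mf => //; exact: emeasurable_itv.
have tail (k : nat) : P (F (s * 4 ^+ k)%R) <= (8^-1 ^+ k)%R%:E.
  pose u := (s * 4 ^+ k)%R.
  pose S n := [set w | forall i : 'I_n, (`|X i w| <= u)%R].
  have mI : measurable ([set x : R | `|x| <= u]%R).
    rewrite (_ : [set x | _] = `[(- u)%R, u]%classic); first exact: measurable_itv.
    by apply/seteqP; split => x; rewrite /= in_itv/= ler_norml.
  have mS n : measurable (S n).
    exact: (measurable_rectangle (fun i : 'I_n => mX i) (fun=> mI)).
  have mG n : measurable (~` S n) by exact: measurableC.
  have FE : F u = \bigcup_n ~` S n.
    apply/seteqP; split => w.
      move=> /seq_sup_gtP[i ui]; exists i.+1 => //; apply/existsNP.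
      by exists ord_max => /=; apply/negP; rewrite -ltNge.
    move=> [n _ /existsNP[i /negP]]; rewrite -ltNge => ui.
    by apply/seq_sup_gtP; exists i.
  have ndG : nondecreasing_seq (fun n => ~` S n).
    move=> m n mn; apply/subsetPset; apply: subsetC => w /= H i.
    exact: (H (widen_ord mn i)).
  have Pcvg := @nondecreasing_cvg_mu _ _ _ P _ mG (bigcup_measurable (fun k _ => mG k)) ndG.
  rewrite -/u FE.
  rewrite -(cvg_lim _ Pcvg)//; apply: lime_le; first by apply: cvgP Pcvg.
  apply: nearW => n /=; rewrite probability_setC//.
  have cX' (i : 'I_n) : centered_L2 P (X i) by exact: cX.
  have a0 : (15 / 16 <= prob_sup_le (fun i : 'I_n => X i) s)%R.
    have := prob_sup_abs_ge (e := (1 / 32)%R) (s := s) (gX n) cX'.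
    have -> : (1 - 1 / 32 = 31 / 32 :> R)%R by field.
    move=> /(_ (Hs n)); lra.
  have := fernique_tail (gX n) cX' s0 a0 k.
  rewrite /prob_sup_le -/u => T.
  rewrite -(fineK (fin (mS n))) -EFinB lee_fin (le_trans T)//.
  by rewrite ler_pdivrMr// ler_peMr ?exprn_ge0//; lra.
pose h N w := mine (f w) (s * 4 ^+ N)%R%:E.
have c0 N : (0 < s * 4 ^+ N)%R by rewrite mulr_gt0// exprn_gt0.
have mh N : measurable_fun setT (h N) by apply: measurable_mine.
have h0 N w : 0 <= h N w by rewrite le_min f0 lee_fin ltW.
have cS N : (s * 4 ^+ N <= s * 4 ^+ N.+1)%R.
  by rewrite ler_pM2l// exprS ler_peMl ?exprn_ge0//; lra.
have hle N w : h N w <= (s * 4 ^+ N)%R%:E by rewrite /h ge_min lexx orbT.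
have hS N w : h N.+1 w <= h N w + (s * 4 ^+ N.+1 * \1_(F (s * 4 ^+ N)) w)%R%:E.
  rewrite indicE; have [wF|wF] := boolP (w \in F (s * 4 ^+ N)%R).
    by rewrite mulr1 (le_trans (hle _ _))// leeDr.
  have fle : f w <= (s * 4 ^+ N)%R%:E.
    by rewrite leNgt; apply/negP => H; move/negP: wF; apply; apply/mem_set.
  by rewrite mulr0 adde0 /h !min_l// (le_trans fle)// lee_fin.
(* The increments are at most [4 s * 2 ^ - k], and [8 s (1 - 2 ^ - N)] is their sum over [k < N]. *)
have bnd N : \int[P]_w h N w <= (s + 8 * s * (1 - 2^-1 ^+ N))%R%:E.
  elim: N => [|N IH].
    rewrite expr0 subrr mulr0 addr0.
    apply: (@le_trans _ _ (\int[P]_w s%:E)); last by rewrite integral_probability_cst.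
    apply: ge0_le_integral => //.
    by move=> w _; have := hle 0%N w; rewrite expr0 mulr1.
  have mi : measurable_fun setT (fun w => (s * 4 ^+ N.+1 * \1_(F (s * 4 ^+ N)) w)%R%:E).
    by apply/measurable_EFinP/measurable_funM => //; exact: measurable_indic.
  have i0 w : 0 <= (s * 4 ^+ N.+1 * \1_(F (s * 4 ^+ N)) w)%R%:E.
    by rewrite lee_fin mulr_ge0// ltW.
  apply: (@le_trans _ _ (\int[P]_w (h N w + (s * 4 ^+ N.+1 * \1_(F (s * 4 ^+ N)) w)%R%:E))).
    apply: ge0_le_integral => //; exact: emeasurable_funD.
  rewrite ge0_integralD//.
  under [X in _ + X]eq_integral do rewrite EFinM.
  rewrite ge0_integralZl//; last 2 first.
  - by apply/measurable_EFinP; exact: measurable_indic.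
  - by rewrite lee_fin ltW.
  rewrite integral_indic// setIT.
  have T : (s * 4 ^+ N.+1)%:E * P (F (s * 4 ^+ N)%R) <= (s * 4 ^+ N.+1 * 8^-1 ^+ N)%R%:E.
    by rewrite [leRHS]EFinM lee_wpmul2l// lee_fin ltW.
  apply: (le_trans (leeD IH T)); rewrite -EFinD lee_fin.
  rewrite !exprS.
  have -> : (s * (4 * 4 ^+ N) * 8^-1 ^+ N = 4 * s * 2^-1 ^+ N)%R.
    have -> : (2^-1 ^+ N = 4 ^+ N * 8^-1 ^+ N :> R)%R.
      by rewrite -exprMn; congr (_ ^+ _)%R; field.
    ring.
  by rewrite le_eqVlt; apply/orP; left; apply/eqP; field.
have grow (A : R) : \forall N \near \oo, (A <= s * 4 ^+ N)%R.
  exists (Num.truncn `|A / s|%R).+1 => // N /= NA.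
  rewrite -ler_pdivrMl// mulrC (le_trans (ler_norm _))//.
  apply: (@le_trans _ _ N%:R%R).
    by rewrite (le_trans (ltW (truncnS_gt _)))// ler_nat.
  by rewrite -natrX ler_nat ltnW// ltn_expl.
have hcvg w : h N w @[N --> \oo] --> f w.
  have := f0 w; case E : (f w) => [r| |]// _.
    apply: cvg_near_cst; near=> N.
    by rewrite /h E min_l// lee_fin; near: N; exact: grow.
  apply/cvgeyPge => A; near=> N.
  by rewrite /h E min_r ?leey// lee_fin; near: N; exact: grow.
have fE w : limn (h ^~ w) = f w by apply/cvg_lim.
have ndh w : nondecreasing_seq (h ^~ w).
  by apply/nondecreasing_seqP => N; apply: le_min2 => //; rewrite lee_fin.
have C := @cvg_monotone_convergence _ _ _ P setT measurableT h (fun N => mh N)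
  (fun N w _ => h0 N w) (fun w _ => ndh w).
apply: (@le_lt_trans _ _ (9 * s)%R%:E); last exact: ltry.
rewrite -/f; under eq_integral do rewrite -fE.
rewrite -(cvg_lim _ C)//; apply: lime_le; first by apply: cvgP C.
apply: nearW => N; apply: (le_trans (bnd N)); rewrite lee_fin.
have : (0 <= 2^-1 ^+ N :> R)%R by rewrite exprn_ge0.
by move=> H; have := mulr_ge0 (ltW s0) H; lra.
Unshelve. all: by end_near. Qed.

End fernique.

(** * Anticoncentration of finite maxima *)

Section standard_normal_density.
Context {R : realType}.
Local Notation phi := (@normal_pdf R 0 1).

Lemma standard_normal_pdfE (x : R) : phi x = (phi 0 * expR (- (x ^+ 2 / 2)))%R.
Proof.
rewrite !normal_pdfE ?oner_eq0// /normal_fun !subr0 expr0n/= oppr0 mul0r expR0 mulr1.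
by congr (_ * expR _)%R; rewrite expr1n mulNr.
Qed.

Lemma standard_normal_pdf_le (x y : R) : (0 <= x)%R -> (x <= y)%R -> (phi y <= phi x)%R.
Proof.
move=> x0 xy; rewrite (standard_normal_pdfE x) (standard_normal_pdfE y).
rewrite ler_wpM2l ?normal_pdf_ge0// ler_expR lerN2 ler_pM2r//.
by rewrite lerXn2r// nnegrE (le_trans x0).
Qed.

Lemma expR_half_le2 (x : R) : (x <= 1 / 2)%R -> (expR x <= 2)%R.
Proof.
move=> x2; rewrite -[x]opprK expRN -[leRHS]invrK lef_pV2 ?posrE ?expR_gt0 ?invr_gt0//.
by have := expR_ge1Dx (- x)%R; lra.
Qed.

(** The ratio of densities is [exp ((y - x) (y + x) / 2)]; the exponent is at most
    [(y - x) y <= 1 / 2]. *)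
Lemma standard_normal_pdf_double (x y : R) : (0 <= x)%R -> (x <= y)%R ->
  ((y - x) * y <= 1 / 2)%R -> (phi x <= 2 * phi y)%R.
Proof.
move=> x0 xy H.
have -> : phi x = (phi y * expR ((y ^+ 2 - x ^+ 2) / 2))%R.
  rewrite (standard_normal_pdfE x) (standard_normal_pdfE y) -mulrA -expRD.
  by congr (_ * expR _)%R; field.
rewrite mulrC ler_wpM2r ?normal_pdf_ge0// expR_half_le2//.
by apply: le_trans H; nra.
Qed.

(** The density decreases only on the nonnegative half-line; when [u < 0] the interval may contain
    the mode, hence the maximum with 0. *)
Lemma normal_prob_itv_le (u v : R) : (u <= v)%R ->
  normal_prob 0 1 `]u, v]%classic <= ((v - u) * phi (Num.max u 0))%:E.
Proof.
move=> uv; rewrite /normal_prob.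
apply: (@le_trans _ _ (\int[lebesgue_measure]_(x in `]u, v]%classic) (phi (Num.max u 0))%:E)).
  apply: ge0_le_integral => //.
  - by move=> x _; rewrite lee_fin normal_pdf_ge0.
  - by apply/measurable_EFinP/measurable_funTS; exact: measurable_normal_pdf.
  - move=> x /=; rewrite in_itv/= => /andP[ux _]; rewrite lee_fin.
    have [u0|u0] := leP u 0%R; last by rewrite standard_normal_pdf_le// ltW.
    have [x0|x0] := leP 0%R x; first exact: standard_normal_pdf_le.
    rewrite -[phi x](@normal_pdfN R 1 x) ?oner_eq0//.
    by rewrite standard_normal_pdf_le// oppr_ge0 ltW.
rewrite integral_cst//= lebesgue_measure_itv/= lte_fin.
case: ifPn => [_|]; first by rewrite -EFinB -EFinM mulrC.
by rewrite mule0 lee_fin mulr_ge0 ?subr_ge0// normal_pdf_ge0.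
Qed.

Lemma cvg_standard_normal_pdf : phi x @[x --> +oo%R] --> (0 : R)%R.
Proof.
have g0 : (0 < phi 0)%R.
  by rewrite normal_pdfE ?oner_eq0// mulr_gt0 ?expR_gt0// normal_peak_gt0// oner_eq0.
apply/cvgrPdist_lt => e e0; near=> x.
have x0 : (0 < x)%R by near: x; exact: nbhs_pinfty_gt.
rewrite sub0r normrN ger0_norm ?normal_pdf_ge0// standard_normal_pdfE.
have : (expR (- (x ^+ 2 / 2)) <= (x ^+ 2 / 2)^-1)%R.
  rewrite expRN lef_pV2 ?posrE ?expR_gt0 ?divr_gt0 ?exprn_gt0//.
  by have := expR_ge1Dx (x ^+ 2 / 2); lra.
move=> H; apply: (le_lt_trans (ler_wpM2l (ltW g0) H)).
rewrite invf_div mulrA ltr_pdivrMr ?exprn_gt0//.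
have x1 : (1 <= x)%R by near: x; exact: nbhs_pinfty_ge.
have : (2 * phi 0 / e < x)%R by near: x; apply: nbhs_pinfty_gt; exact: num_real.
rewrite ltr_pdivrMr// [(2 * _)%R]mulrC => H2; apply: (lt_le_trans H2).
by rewrite mulrC ler_pM2l// expr2 ler_peMr// ltW.
Unshelve. all: by end_near. Qed.

(** [- phi] is an antiderivative of [x * phi x] and vanishes at infinity. The hypothesis on [y]
    makes the integrand nonnegative. *)
Lemma integral_id_standard_normal (y : R) : (0 <= y)%R ->
  \int[normal_prob 0 1]_x (x * \1_(`]y, +oo[%classic) x)%:E = (phi y)%:E.
Proof.
move=> y0.
have mI : measurable_fun setT (fun x : R => (x * \1_(`]y, +oo[%classic) x)%:E).
  by apply/measurable_EFinP/measurable_funM => //; exact: measurable_indic.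
have mp : measurable_fun setT phi by exact: measurable_normal_pdf.
rewrite ge0_integral_normal_prob//; last first.
  move=> x; rewrite lee_fin indicE; have [|_] := boolP (_ \in _); last by rewrite mulr0.
  by rewrite inE/= in_itv/= andbT mulr1 => /ltW; exact: le_trans.
transitivity (\int[lebesgue_measure]_(x in `]y, +oo[%classic) (x * phi x)%:E).
  rewrite [RHS]integral_mkcond; apply: eq_integral => x _.
  rewrite patchE indicE; case: ifPn => _; first by rewrite mulr1 EFinM.
  by rewrite mulr0 mul0e.
rewrite integral_itv_obnd_cbnd; last first.
  by apply/measurable_EFinP/measurable_funTS/measurable_funM.
have cp : continuous phi by apply: continuous_normal_pdf; exact: oner_neq0.
have dp (x : R) : is_derive (x : R) (1 : R)%R (- phi)%R (x * phi x)%R.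
  have H := is_derive_normal_pdf x (oner_neq0 R).
  by apply: is_derive_eq; rewrite expr1n divr1 mulNr opprK.
rewrite (@ge0_continuous_FTC2y _ (fun x => x * phi x)%R (- phi)%R y 0%R).
- by rewrite sub0e -EFinN opprK.
- by move=> x yx; rewrite mulr_ge0 ?normal_pdf_ge0// (le_trans y0).
- apply: continuous_subspaceT => x; apply: cvgM; [exact: cvg_id|exact: cp].
- by rewrite -[X in _ --> X]oppr0; apply: cvgN; exact: cvg_standard_normal_pdf.
- by move=> x _; case: (dp x).
- by apply: cvgN; apply: cvg_at_right_filter; exact: cp.
- by move=> x _; rewrite derive1E; case: (dp x).
Qed.

End standard_normal_density.

Section anticoncentration.
Context {R : realType} d (Omega : measurableType d) (P : probability Omega R).

(** Independence says that [P] restricted to [E] has image [P E * m] under [Z]. *)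
Lemma ge0_integral_independent d' (T' : measurableType d') (m : {measure set T' -> \bar R})
    (Z : Omega -> T') (E : set Omega) (f : T' -> \bar R) :
  measurable_fun setT Z -> measurable E ->
  (forall A, measurable A -> P (Z @^-1` A) = m A) ->
  (forall A, measurable A -> P (Z @^-1` A `&` E) = P (Z @^-1` A) * P E) ->
  measurable_fun setT f -> (forall x, 0 <= f x) ->
  \int[P]_(w in E) f (Z w) = P E * \int[m]_x f x.
Proof.
move=> mZ mE lawZ ind mf f0.
have mfZ : measurable_fun setT (fun w => f (Z w)) by exact: measurableT_comp.
transitivity (\int[mrestr P mE]_(w in E) f (Z w)).
  apply: eq_measure_integral => A mA AE.
  by rewrite /= /mrestr setIidl.
have -> : \int[mrestr P mE]_(w in E) f (Z w) = \int[mrestr P mE]_w f (Z w).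
  rewrite [RHS](@ge0_negligible_integral _ _ _ _ setT (~` E)) //.
  - by rewrite setTD setCK.
  - exact: measurableC.
  - by rewrite /= /mrestr setICl measure0.
have PE0 : (0 <= fine (P E))%R by apply: fine_ge0; exact: measure_ge0.
have PEE : (fine (P E))%:E = P E by rewrite fineK// fin_num_measure.
rewrite (@ge0_integral_law _ _ _ _ _ _ (mscale (NngNum PE0) m) Z f)//.
  by rewrite ge0_integral_mscale//= PEE.
by move=> A mA; rewrite /= /mrestr /mscale/= ind// lawZ// PEE muleC.
Qed.

Lemma first_argmax (x : nat -> R) n : (0 < n)%N ->
  exists2 j, (j < n)%N &
    (forall i, (i < n)%N -> x i <= x j)%R /\ (forall i, (i < j)%N -> x i < x j)%R.
Proof.
elim: n => [//|[|n] IH _].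
  by exists 0%N => //; split => [[|i]|].
have [j jn [H1 H2]] := IH isT.
have [xx|xx] := leP (x n.+1) (x j).
  exists j; first exact: leqW.
  split=> // i; rewrite ltnS leq_eqVlt => /predU1P[->//|]; exact: H1.
exists n.+1 => //; split => i.
  by rewrite ltnS leq_eqVlt => /predU1P[->//|/H1/le_trans]; apply; exact: ltW.
by move=> /H1/le_lt_trans; apply.
Qed.

Variable X : nat -> Omega -> R.
Hypothesis gX : forall n, multivariate_normal P (fun i : 'I_n => X i).
Hypothesis cX : forall k, centered_L2 P (X k).
Hypothesis vX : forall k, (\int[P]_w X k w ^+ 2 = 1)%R.
Hypothesis lawX : forall k A, measurable A -> P (X k @^-1` A) = normal_prob 0 1 A.

Let mX k : measurable_fun setT (X k). Proof. by case: (cX k). Qed.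

Let rho i j : R := (\int[P]_w (X i w * X j w))%R.

Let W j i w : R := (X i w - rho i j * X j w)%R.

Let rho_le1 i j : (rho i j <= 1)%R.
Proof.
have [mi i2 _] := cX i; have [mj j2 _] := cX j.
have ij := integrable_mulL2 mi i2 mj j2.
have : (2 * rho i j <= 1 + 1)%R.
  have -> : (1 + 1 = \int[P]_w X i w ^+ 2 + \int[P]_w X j w ^+ 2)%R by rewrite !vX.
  rewrite /rho -RintegralZl// -RintegralD//.
  apply: le_Rintegral => //.
  - exact: (integrableZl measurableT 2%R ij).
  - exact: (integrableD measurableT i2 j2).
  - by move=> w _; have := sqr_ge0 (X i w - X j w)%R; rewrite sqrrB mulr2n; lra.
lra.
Qed.

(* The event that [j] is the first index where [X] is maximal is
   [argmax_ev n j (X j w)]; by [residual_cos] it is, for a fixed level [y],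
   independent of [X j], and it increases with [y] because [rho i j <= 1]. *)
Let bound (j i : nat) (y : R) : set R :=
  if (i < j)%N then [set x | (x < (1 - rho i j) * y)%R]
  else [set x | (x <= (1 - rho i j) * y)%R].

Let argmax_ev n j (y : R) : set Omega := [set w | forall i : 'I_n, bound j i y (W j i w)].

Let measurable_bound j i y : measurable (bound j i y).
Proof.
rewrite /bound; case: ifP => _.
  rewrite (_ : [set x | _] = `]-oo, ((1 - rho i j) * y)%R[%classic); first exact: measurable_itv.
  by apply/seteqP; split => x /=; rewrite in_itv/=.
rewrite (_ : [set x | _] = `]-oo, ((1 - rho i j) * y)%R]%classic); first exact: measurable_itv.
by apply/seteqP; split => x /=; rewrite in_itv/=.
Qed.

Let mW j i : measurable_fun setT (W j i).
Proof. by apply: measurable_funB => //; exact: measurable_funM. Qed.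

Let measurable_argmax_ev n j y : measurable (argmax_ev n j y).
Proof.
exact: (@measurable_rectangle _ _ _ _ (fun (i : 'I_n) => W j i) (fun i => bound j i y)).
Qed.

Let argmax_ev_le n j y z : (y <= z)%R -> argmax_ev n j y `<=` argmax_ev n j z.
Proof.
move=> yz w /= H i; have := H i; rewrite /bound.
have r0 : (0 <= 1 - rho i j)%R by rewrite subr_ge0.
have := ler_wpM2l r0 yz.
by case: ifP => _ /= le H0; [exact: lt_le_trans H0 le|exact: le_trans H0 le].
Qed.

Let argmax_evP n j w : argmax_ev n j (X j w) w <->
  (forall i : 'I_n, X i w <= X j w)%R /\ (forall i : 'I_n, (i < j)%N -> X i w < X j w)%R.
Proof.
have E i : ((1 - rho i j) * X j w = X j w - rho i j * X j w)%R by rewrite mulrBl mul1r.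
split=> [H|[H1 H2] i].
  split=> i; have := H i; rewrite /bound /W E.
    by case: ifP => _ /=; [rewrite ltrD2r => /ltW|rewrite lerD2r].
  by move=> + ij; rewrite ij /= ltrD2r.
rewrite /bound /W E; case: ifP => ij /=; first by rewrite ltrD2r; exact: H2.
by rewrite lerD2r; exact: H1.
Qed.

Let argmax_ev_independent n (j : 'I_n) y A : measurable A ->
  P (X j @^-1` A `&` argmax_ev n j y) = P (X j @^-1` A) * P (argmax_ev n j y).
Proof.
move=> mA.
apply: (@independent_of_cos R d Omega P n (X j) (fun i : 'I_n => W j i)
  (fun a => expR (- (\int[P]_w (\sum_(i < n) a i * W j i w) ^+ 2 / 2)))%R
  (fun t => expR (- (t ^+ 2 / 2)))%R _ _ _ A (fun i : 'I_n => bound j i y)) => // a t c.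
have := @residual_cos R d Omega P n (fun i : 'I_n => X i) j (fun i => rho i j) (@gX n)
  (fun i => cX i) (vX j) (fun=> erefl) a t c.
exact.
Qed.

(** At a fixed level the events for different [j] may overlap, so this sum can exceed 1. Its meaning
    is that [phi y * G n y] is the density at [y] of the partial maximum. *)
Let G n y : \bar R := \sum_(j < n) P (argmax_ev n j y).

Let G_le n y z : (y <= z)%R -> G n y <= G n z.
Proof.
move=> yz; apply: lee_sum => j _; apply: le_measure; rewrite ?inE//.
exact: argmax_ev_le.
Qed.

Definition max_in n (u v : R) : set Omega :=
  [set w | (forall i : 'I_n, (X i w <= v)%R) /\ exists i : 'I_n, (u < X i w)%R].

Lemma measurable_max_in n u v : measurable (max_in n u v).
Proof.
have mI x : measurable ([set y : R | (y <= x)%R]).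
  rewrite (_ : [set y | _] = `]-oo, x]%classic); first exact: measurable_itv.
  by apply/seteqP; split => y /=; rewrite in_itv/=.
have mS x : measurable [set w | forall i : 'I_n, (X i w <= x)%R].
  exact: (measurable_rectangle (fun i : 'I_n => mX i) (fun=> mI x)).
rewrite (_ : max_in n u v = [set w | forall i : 'I_n, (X i w <= v)%R] `&`
   ~` [set w | forall i : 'I_n, (X i w <= u)%R]).
  by apply: measurableI => //; exact: measurableC.
apply/seteqP; split => w /= [H1].
  by move=> [i ui]; split => // /(_ i); rewrite leNgt ui.
by move=> /existsNP[i /negP]; rewrite -ltNge => ui; split => //; exists i.
Qed.

(** On the event, the first argmax [j] has [X j w <= v]. Raising the random level [X j w] to the
    fixed [v] enlarges the argmax event and makes it independent of [X j]. *)
Lemma max_in_le n u v : P (max_in n u v) <= normal_prob 0 1 `]u, v]%classic * G n v.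
Proof.
pose F (j : nat) := X j @^-1` `]u, v]%classic `&` argmax_ev n j v.
have mF j : measurable (F j).
  by apply: measurableI => //; rewrite -[X in measurable X]setTI; apply: mX => //; exact: measurable_itv.
apply: (@le_trans _ _ (\sum_(j < n) P (F j))).
  apply: content_subadditive => //; first exact: measurable_max_in.
  move=> w [Hv [i ui]].
  have n0 : (0 < n)%N by exact: leq_ltn_trans (ltn_ord i).
  have [j jn [H1 H2]] := first_argmax (fun k => X k w) n0.
  rewrite -bigcup_mkord; exists j => //; split => /=.
    rewrite in_itv/= (lt_le_trans ui (H1 _ (ltn_ord i)))/=.
    exact: (Hv (Ordinal jn)).
  apply: (argmax_ev_le (Hv (Ordinal jn))); apply/argmax_evP; split=> k; first exact: H1.
  by move=> /H2.
rewrite /G ge0_sume_distrr//.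
by apply: lee_sum => j _; rewrite /F argmax_ev_independent// lawX.
Qed.

(** To be instantiated with the positive part of the supremum; as one [M] dominates every [X k], the
    bounds below do not depend on [n]. *)
Variable M : Omega -> \bar R.
Hypotheses (mM : measurable_fun setT M) (M0 : forall w, 0 <= M w).
Hypothesis XM : forall k w, (X k w)%:E <= M w.

(** When [X j w > y], the event at level [y] is contained in the true argmax event, so at most one
    [j] contributes at each [w], and its contribution [X j w] is at most [M w]. Integrating term by
    term with independence gives [phi y] times each probability. *)
Lemma max_density_le n y : (0 <= y)%R -> (normal_pdf 0 1 y)%:E * G n y <= \int[P]_w M w.
Proof.
move=> y0.
pose psi (x : R) : \bar R := (x * \1_(`]y, +oo[%classic) x)%:E.
have psi0 x : 0 <= psi x.
  rewrite /psi lee_fin indicE; have [|_] := boolP (_ \in _); last by rewrite mulr0.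
  by rewrite inE/= in_itv/= andbT mulr1 => /ltW; exact: le_trans.
have mpsi : measurable_fun setT psi.
  by apply/measurable_EFinP/measurable_funM => //; exact: measurable_indic.
have mpX j : measurable_fun setT (fun w => psi (X j w)) by exact: measurableT_comp.
have E (j : 'I_n) : \int[P]_w (((fun w => psi (X j w)) \_ (argmax_ev n j y)) w) =
    P (argmax_ev n j y) * (normal_pdf 0 1 y)%:E.
  rewrite -integral_mkcond -(integral_id_standard_normal y0).
  exact: (@ge0_integral_independent _ _ (normal_prob 0 1) _ _ _ (mX j)
    (measurable_argmax_ev n j y) (@lawX j) (@argmax_ev_independent n j y) mpsi psi0).
have -> : (normal_pdf 0 1 y)%:E * G n y =
    \sum_(j < n) \int[P]_w (((fun w => psi (X j w)) \_ (argmax_ev n j y)) w).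
  rewrite /G ge0_sume_distrr//.
  by apply: eq_bigr => j _; rewrite E muleC.
have mr (j : 'I_n) : measurable_fun setT ((fun w => psi (X j w)) \_ (argmax_ev n j y)).
  by apply/(measurable_restrictT _ _).1 => //; exact: measurable_funTS.
have r0 (j : 'I_n) w : 0 <= ((fun w => psi (X j w)) \_ (argmax_ev n j y)) w.
  by rewrite patchE; case: ifP.
rewrite -ge0_integral_sum//.
apply: ge0_le_integral => //.
- by move=> w _; apply: sume_ge0 => j _; exact: r0.
- exact: emeasurable_sum.
move=> w _.
have [[j0 [E0 yX]]|H] := pselect (exists j : 'I_n, argmax_ev n j y w /\ (y < X j w)%R); last first.
  rewrite big1// => j _; rewrite patchE; case: ifPn => // /set_mem Ej.
  rewrite /psi indicE memNset ?mulr0//= in_itv/= andbT => yX.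
  by apply: H; exists j.
have /argmax_evP [A1 A2] := argmax_ev_le (ltW yX) E0.
rewrite (bigD1 j0)//= big1 ?adde0.
  rewrite patchE; case: ifPn => // _; rewrite /psi (le_trans _ (XM j0 w))// lee_fin.
  by rewrite indicE mem_set ?mulr1//= in_itv/= yX.
move=> j jj0; rewrite patchE; case: ifPn => // /set_mem Ej.
rewrite /psi indicE memNset ?mulr0//= in_itv/= andbT => yXj.
have /argmax_evP [B1 B2] := argmax_ev_le (ltW yXj) Ej.
(* Two first argmaxes coincide: the later one would strictly exceed the earlier, which is itself
   maximal. *)
have [lt|lt|/val_inj eq] := ltngtP j j0.
- by have := A2 _ lt; rewrite ltNge B1.
- by have := B2 _ lt; rewrite ltNge A1.
- by rewrite eq eqxx in jj0.
Qed.

(** The density comes from the left end and [G] from the right end, both cut off at 0. The smallness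
    condition is what moves the density to the right end at the cost of a factor 2; for [v <= 0]
    both cut-off levels are 0. *)
Lemma max_in_local n u v : (u <= v)%R -> ((v - u) * Num.max v 0 <= 1 / 2)%R ->
  P (max_in n u v) <= (2 * (v - u))%:E * \int[P]_w M w.
Proof.
move=> uv small; pose y := Num.max v 0%R; pose x := Num.max u 0%R.
have y0 : (0 <= y)%R by rewrite le_max lexx orbT.
have x0 : (0 <= x)%R by rewrite le_max lexx orbT.
have xy : (x <= y)%R by rewrite ge_max !le_max uv lexx orbT.
have vu0 : (0 <= v - u)%R by rewrite subr_ge0.
have D : (normal_pdf 0 1 x <= 2 * normal_pdf 0 1 y)%R.
  apply: standard_normal_pdf_double => //; apply: le_trans small.
  rewrite ler_wpM2r//.
  rewrite /x /y; have [v0|v0] := leP v 0%R; have [u0|u0] := leP u 0%R; lra.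
apply: (le_trans (max_in_le n u v)).
apply: (@le_trans _ _ (((v - u) * normal_pdf 0 1 x)%:E * G n y)).
  apply: lee_pmul; rewrite ?measure_ge0 ?sume_ge0//.
  - exact: normal_prob_itv_le.
  - by apply: G_le; rewrite le_max lexx.
apply: (@le_trans _ _ ((2 * (v - u))%:E * ((normal_pdf 0 1 y)%:E * G n y))); last first.
  by apply: lee_wpmul2l; [rewrite lee_fin mulr_ge0|exact: max_density_le].
rewrite muleA -EFinM; apply: lee_wpmul2r; first by apply: sume_ge0.
rewrite lee_fin (_ : 2 * (v - u) * _ = (v - u) * (2 * normal_pdf 0 1 y))%R; last by ring.
exact: ler_wpM2l.
Qed.

Lemma max_in_bound n u v : (u <= v)%R ->
  P (max_in n u v) <= (2 * (v - u))%:E * \int[P]_w M w.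
Proof.
move=> uv; pose y : R := Num.max v 0%R.
have y0 : (0 <= y)%R by rewrite le_max lexx orbT.
have vu0 : (0 <= v - u)%R by rewrite subr_ge0.
have IM0 : 0 <= \int[P]_w M w by exact: integral_ge0.
(* Chosen so that each piece has [h * y <= 1 / 2]. The same [y] serves all pieces, whose right ends
   are at most [v]; the local bound is linear in the length, so adding up loses nothing. *)
pose N := (Num.truncn (2 * (v - u) * y)).+1.
have N0 : (0 < N%:R :> R)%R by rewrite ltr0n.
pose h := ((v - u) / N%:R)%R.
have h0 : (0 <= h)%R by rewrite divr_ge0// ltW.
have hy : (h * y <= 1 / 2)%R.
  rewrite /h mulrAC ler_pdivrMr//.
  have : (2 * (v - u) * y <= N%:R)%R by apply: ltW; exact: truncnS_gt.
  lra.
have step k : (k <= N)%N -> P (max_in n u (u + k%:R * h)%R) <= (2 * (k%:R * h))%:E * \int[P]_w M w.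
  elim: k => [_|k IH kN].
    rewrite mul0r addr0 mulr0 mul0e (_ : max_in n u u = set0) ?measure0//.
    by apply/seteqP; split => // w [H [i]]; rewrite ltNge H.
  have H1 := IH (ltnW kN).
  pose m := (u + k%:R * h)%R.
  have e : (u + k.+1%:R * h = m + h)%R by rewrite /m -natr1 mulrDl mul1r addrA.
  have mv : (m + h <= v)%R.
    rewrite -e -lerBrDl -[leRHS](divfK (lt0r_neq0 N0)) -/h mulrC ler_wpM2l// ler_nat//.
  have sub : max_in n u (m + h)%R `<=` max_in n u m `|` max_in n m (m + h)%R.
    move=> w [Hv [i ui]].
    have [H|/existsNP[k' /negP]] := pselect (forall i : 'I_n, (X i w <= m)%R).
      by left; split => //; exists i.
    by rewrite -ltNge => mk; right; split => //; exists k'.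
  rewrite e; apply: (@le_trans _ _ (P (max_in n u m `|` max_in n m (m + h)%R))).
    by apply: le_measure; rewrite ?inE//; [exact: measurable_max_in|
      apply: measurableU; exact: measurable_max_in].
  apply: (le_trans (measureU2 _ _ _)); [exact: measurable_max_in|exact: measurable_max_in|].
  have H2 : P (max_in n m (m + h)%R) <= (2 * h)%:E * \int[P]_w M w.
    have := @max_in_local n m (m + h)%R.
    have -> : (m + h - m = h)%R by rewrite addrC addKr.
    apply; first by rewrite lerDl.
    apply: le_trans hy; rewrite ler_wpM2l// /y.
    by rewrite ge_max !le_max mv lexx !orbT.
  apply: (le_trans (leeD H1 H2)).
  rewrite -ge0_muleDl ?lee_fin ?mulr_ge0 -?EFinD//.
  by rewrite lee_wpmul2r// lee_fin -natr1; lra.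
have := step N (leqnn N).
have -> : (N%:R * h = v - u)%R by rewrite /h mulrC divfK// lt0r_neq0.
by rewrite [(u + _)%R]addrC subrK.
Qed.

End anticoncentration.

(** * Anticoncentration of the supremum *)

Section supremum_concentration.
Context {R : realType} d (Omega : measurableType d) (P : probability Omega R).
Variable X : nat -> Omega -> R.
Hypothesis gX : forall n, multivariate_normal P (fun i : 'I_n => X i).
Hypothesis mX : forall k, measurable_fun setT (X k).
Hypothesis EX : forall k, \int[P]_w (X k w)%:E = 0.
Hypothesis VX : forall k, \int[P]_w (X k w ^+ 2)%:E = 1.
Hypothesis X_sup_finite : {ae P, forall w, seq_sup X w < +oo}.

Let X2 k : P.-integrable setT (fun w => (X k w ^+ 2)%:E).
Proof.
apply/integrableP; split; first by apply/measurable_EFinP; exact: measurable_funX.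
under eq_integral do rewrite gee0_abs ?lee_fin ?sqr_ge0//.
by rewrite VX ltry.
Qed.

Let cX k : centered_L2 P (X k).
Proof. by split. Qed.

Let vX k : (\int[P]_w X k w ^+ 2 = 1)%R.
Proof. by rewrite /Rintegral VX. Qed.

Let lawX k A : measurable A -> P (X k @^-1` A) = normal_prob 0 1 A.
Proof.
move=> mA; apply: standard_normal_rv => //.
have := @gX k.+1 (fun i => (i == ord_max)%:R).
congr normal_rv; apply/funext => w.
rewrite (bigD1 ord_max)//= eqxx mul1r big1 ?addr0// => i /negbTE ->.
by rewrite mul0r.
Qed.

Let mS : measurable_fun setT (seq_sup X).
Proof. exact: measurable_seq_sup. Qed.

Let le_seq_sup k w : (X k w)%:E <= seq_sup X w.
Proof. by apply: ereal_sup_ubound; exists k. Qed.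

(** The events [seq_sup X <= N] increase to one of probability 1, so some level has probability at
    least [31 / 32]; being a bound on the full supremum, it serves all [n]. *)
Lemma seq_sup_quantile : exists2 s : R, (0 < s)%R &
  forall n, (31 / 32 <= fine (P [set w | forall i : 'I_n, (X i w <= s)%R]))%R.
Proof.
pose F (N : nat) := [set w | seq_sup X w <= N%:R%:E].
have mF N : measurable (F N).
  by rewrite -[F N]setTI; exact: emeasurable_fun_infty_c.
have mUF : measurable (\bigcup_N F N) by exact: bigcup_measurable.
have PUF : P (\bigcup_N F N) = 1.
  case: X_sup_finite => B [mB B0 sB].
  apply/eqP; rewrite eq_le probability_le1//=.
  have -> : 1 = P (~` B) by rewrite probability_setC// B0 sube0.
  apply: le_measure; rewrite ?inE//; first exact: measurableC.
  move=> w /= Bw; have Sw : seq_sup X w < +oo by apply: contrapT => /sB.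
  case E : (seq_sup X w) Sw => [r| |] // _.
    exists (Num.truncn r).+1 => //; rewrite /F/= E lee_fin ltW//; exact: truncnS_gt.
  by exists 0%N => //; rewrite /F/= E leNye.
have [N PN] : exists N, (31 / 32)%:E <= P (F N).
  apply: contrapT => /forallNP H.
  have : P (\bigcup_N F N) <= (31 / 32)%:E.
    apply: cvge_le (nondecreasing_cvg_mu mF mUF _); last first.
      move=> n m nm; apply/subsetPset => w /le_trans; apply.
      by rewrite lee_fin ler_nat.
    by apply: nearW => N /=; have /negP := H N; rewrite -ltNge => /ltW.
  by rewrite PUF lee_fin; lra.
(* The successor keeps the level positive even when [N = 0]. *)
exists N.+1%:R => [|n]; first by rewrite ltr0n.
have mI : measurable [set w | forall i : 'I_n, (X i w <= N.+1%:R)%R].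
  apply: (measurable_rectangle (fun i : 'I_n => mX i) (B := fun=> [set y | (y <= N.+1%:R)%R])) => _.
  rewrite (_ : [set y | _] = `]-oo, N.+1%:R]%classic); first exact: measurable_itv.
  by apply/seteqP; split => y /=; rewrite in_itv/=.
rewrite -lee_fin fineK ?fin_num_measure//; apply: (le_trans PN).
apply: le_measure; rewrite ?inE// => w /= Fw i.
rewrite -lee_fin (le_trans (le_seq_sup i w))// (le_trans Fw)// lee_fin ler_nat//.
Qed.

(** The absolute supremum dominates: where [seq_sup X] is negative, its modulus is at most
    [|X 0|]. *)
Lemma integrable_seq_sup : P.-integrable setT (seq_sup X).
Proof.
have mA k : measurable_fun setT (fun w => `|X k w|%R).
  exact: (measurableT_comp (@normr_measurable R setT)).
have [s s0 Hs] := seq_sup_quantile.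
have fin := gaussian_sup_abs_integrable gX cX s0 Hs.
have leA k w : `|X k w|%:E <= seq_sup (fun k w => `|X k w|%R) w.
  by apply: ereal_sup_ubound; exists k.
have A0 w : 0 <= seq_sup (fun k w => `|X k w|%R) w.
  by apply: le_trans (leA 0%N w); rewrite lee_fin.
apply: (@le_integrable _ _ _ P setT measurableT _ (seq_sup (fun k w => `|X k w|%R))) => //.
- move=> w _; rewrite [leRHS]gee0_abs//; have [S0|S0] := leP 0 (seq_sup X w).
    rewrite gee0_abs//; apply: ge_ereal_sup => _ [k _ <-].
    by apply: le_trans (leA k w); rewrite lee_fin ler_norm.
  rewrite lte0_abs//; apply: le_trans (leA 0%N w).
  rewrite leeNl -EFinN; apply: le_trans (le_seq_sup 0%N w).
  by rewrite lee_fin lerNl -normrN ler_norm.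
- apply/integrableP; split; first exact: measurable_seq_sup.
  by rewrite (eq_integral (seq_sup (fun k w => `|X k w|%R)))// => w _; rewrite gee0_abs.
Qed.

(** [X 0 + (1 + X 0 ^ 2) / 2 = (1 + X 0) ^ 2 / 2] is nonnegative and [X 0] is below the supremum, so
    adding [h] lifts the supremum above its positive part. *)
Lemma integral_seq_sup_pos :
  \int[P]_w (seq_sup X)^\+ w <= \int[P]_w seq_sup X w + 1.
Proof.
pose h w := ((1 + X 0%N w ^+ 2) / 2)%R.
have i1 : P.-integrable setT (fun w => (1 + X 0%N w ^+ 2)%:E).
  apply: (@integrableD _ _ _ P setT measurableT (cst 1) (fun w => (X 0%N w ^+ 2)%:E)) => //.
  exact: finite_measure_integrable_cst.
have hE : (EFin \o h) = fun w => 2^-1%:E * (1 + X 0%N w ^+ 2)%:E.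
  by apply/funext => w; rewrite /h /= mulrC EFinM.
have ih : P.-integrable setT (EFin \o h) by rewrite hE; exact: integrableZl.
have Eh : \int[P]_w (h w)%:E = 1.
  under eq_integral => w _ do rewrite [(h w)%:E](congr1 (@^~ w) hE).
  rewrite integralZl//; under eq_integral do rewrite EFinD.
  rewrite integralD//; last exact: finite_measure_integrable_cst.
  by rewrite VX integral_probability_cst -EFinD -EFinM -[(1 + 1)%R]/(2%R) mulVf.
rewrite -Eh -integralD//; last exact: integrable_seq_sup.
have le w : (seq_sup X)^\+ w <= seq_sup X w + (h w)%:E.
  have h0 : (0 <= h w)%R by rewrite divr_ge0// addr_ge0// sqr_ge0.
  rewrite funeposE ge_max leeDl ?lee_fin//=.
  apply: (@le_trans _ _ ((X 0%N w)%:E + (h w)%:E)); last by rewrite leeD2r.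
  rewrite -EFinD lee_fin /h.
  have := sqr_ge0 (1 + X 0%N w)%R; rewrite sqrrD expr1n mul1r mulr2n; lra.
apply: ge0_le_integral => //.
- exact: measurable_funepos.
- exact: (emeasurable_funD mS (measurable_int P ih)).
Qed.

Lemma seq_sup_bound (u v : R) : (u <= v)%R ->
  P [set w | u%:E < seq_sup X w <= v%:E] <=
    (2 * (v - u))%:E * \int[P]_w (seq_sup X)^\+ w.
Proof.
move=> uv.
(* [max_in X n u v] alone is not monotone in [n], as a later variable may exceed [v]; intersecting
   with [seq_sup X <= v] makes the events increase. *)
pose C n := max_in X n u v `&` [set w | seq_sup X w <= v%:E].
have mC n : measurable (C n).
  apply: measurableI; first exact: measurable_max_in.
  by rewrite -[X in measurable X]setTI; exact: emeasurable_fun_infty_c.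
have -> : [set w | u%:E < seq_sup X w <= v%:E] = \bigcup_n C n.
  apply/seteqP; split => w /=.
    move=> /andP[/seq_sup_gtP[k uk] Sv]; exists k.+1 => //; split => //.
    split; last by exists ord_max.
    by move=> i; rewrite -lee_fin (le_trans (le_seq_sup i w)).
  by move=> [n _ [[_ [i ui]] Sv]]; apply/andP; split => //; apply/seq_sup_gtP; exists i.
apply: cvge_le (nondecreasing_cvg_mu mC _ _); last 2 first.
- exact: bigcup_measurable.
- move=> n m nm; apply/subsetPset => w [[_ [i ui]] Sv]; split => //; split.
    by move=> j; rewrite -lee_fin (le_trans (le_seq_sup j w)).
  by exists (widen_ord nm i).
apply: nearW => n /=.
apply: (@le_trans _ _ (P (max_in X n u v))).
  by apply: le_measure; rewrite ?inE//; [exact: measurable_max_in|exact: subIsetl].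
apply: (@max_in_bound _ _ _ P X gX cX vX lawX) => //.
- exact: measurable_funepos.
- by move=> k w; apply: (le_trans (le_seq_sup k w)); rewrite funeposE le_max lexx.
Qed.

End supremum_concentration.

(** Off the null set each [X tau w] is a limit of values on the countable set, hence at most their
    supremum. *)
Lemma separable_process_enumeration (R : realType) (d : measure_display)
    (Omega : measurableType d) (P : probability Omega R)
    (T : pseudoMetricType R) (X : T -> {RV P >-> R}) :
  [set: T] !=set0 -> is_separable_process X ->
  exists t : nat -> T,
    {ae P, forall w, process_sup X w = seq_sup (fun k => X (t k) : Omega -> R) w}.
Proof.
move=> [t0 _] [T0 [N [cT0 negN sepN]]].
have /countable_injP[f finj] := cT0.
have [t tT0] : {t : nat -> T | forall s, T0 s -> exists k, t k = s}.
  apply: cid; have ex k : exists s, forall s', T0 s' -> f s' = k -> s = s'.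
    have [[s [Ts fs]]|H] := pselect (exists s, T0 s /\ f s = k).
      by exists s => s' Ts' fs'; apply: finj; rewrite ?inE// fs.
    by exists t0 => s' Ts' fs'; exfalso; apply: H; exists s'.
  have [t Ht] := choice ex.
  by exists t => s Ts; exists (f s); exact: Ht.
exists t; apply: negligibleS negN => w; apply: contra_notP => Nw.
apply/eqP; rewrite eq_le; apply/andP; split; last first.
  by apply: ge_ereal_sup => _ [k _ <-]; apply: ereal_sup_ubound; exists (t k).
apply: ge_ereal_sup => _ [tau _ <-].
have [s [sT0 _ sX]] := sepN w Nw tau.
have sXE : (fun k => (X (s k) w)%:E) @ \oo --> (X tau w)%:E by apply: cvg_EFin => //; exact: nearW.
apply: cvge_le sXE; apply: nearW => k.
by have [j <-] := tT0 _ (sT0 k); apply: ereal_sup_ubound; exists j.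
Qed.

Theorem theorem2p1 (R : realType) (d : measure_display)
    (Omega : measurableType d) (P : probability Omega R)
    (T : pseudoMetricType R) (X : T -> {RV P >-> R})
    (P_complete : measure_is_complete P)
    (T_nonempty : [set: T] !=set0)
    (X_separable : is_separable_process X)
    (X_gaussian : is_gaussian_process X)
    (X_mean0 : forall t : T, 'E_P[X t] = 0)
    (X_var1 : forall t : T, 'E_P[fun w => (X t w ^+ 2)%R] = 1)
    (X_sup_finite : {ae P, forall w, process_sup X w < +oo}) :
  let aX := \int[P]_w process_sup X w in
  [/\ P.-integrable [set: Omega] (process_sup X),
      0 <= aX < +oo &
      forall eps : R, (0 <= eps)%R ->
        ereal_sup [set P [set w | `|process_sup X w - x%:E| <= eps%:E]
                  | x in [set: R]]
        <= (4 * eps)%:E * (aX + 1)].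
Proof.
move=> aX.
have [t supE] := separable_process_enumeration T_nonempty X_separable.
pose Y (k : nat) : Omega -> R := X (t k).
have gY n : multivariate_normal P (fun i : 'I_n => Y i).
  exact: (X_gaussian n (fun i => t i)).
have mY k : measurable_fun setT (Y k) by exact: measurable_funPT.
have EY k : \int[P]_w (Y k w)%:E = 0 by have := X_mean0 (t k); rewrite unlock.
have VY k : \int[P]_w (Y k w ^+ 2)%:E = 1 by have := X_var1 (t k); rewrite unlock.
have Yfin : {ae P, forall w, seq_sup Y w < +oo}.
  by apply: filterS2 supE X_sup_finite => w ->.
have mSY : measurable_fun setT (seq_sup Y) by exact: measurable_seq_sup.
have iY := integrable_seq_sup gY mY EY VY Yfin.
have aeE : ae_eq P setT (seq_sup Y) (process_sup X).
  by apply: filterS supE => w -> _.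
(* A supremum over an arbitrary index set; completeness of [P] carries measurability over from the
   almost surely equal sequential supremum. *)
have mS : measurable_fun setT (process_sup X) by exact: ae_measurable_fun aeE mSY.
have aXE : aX = \int[P]_w seq_sup Y w by apply/esym/ae_eq_integral.
have a_fin : aX \is a fin_num by rewrite aXE; exact: integrable_fin_num.
have a_ge0 : 0 <= aX.
  rewrite -(EY 0%N) aXE; apply: le_integral => //.
    by have [] := square_integrable_integrable (mY 0%N) (VY 0%N).
  by move=> w _; apply: ereal_sup_ubound; exists 0%N.
split.
- apply/integrableP; split=> //.
  have [_] := integrableP _ _ _ iY; congr (_ < _).
  by apply: ae_eq_integral => //; [exact: measurableT_comp|exact: measurableT_comp|exact: ae_eq_abse].
- by rewrite a_ge0 ltey_eq a_fin.
move=> eps eps0; apply: ge_ereal_sup => _ [x _ <-].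
have [a aE] : exists a, aX = a%:E by exists (fine aX); rewrite fineK.
have a0 : (0 <= a)%R by rewrite -lee_fin -aE.
(* The estimate for the supremum concerns half-open intervals, so the closed one is placed inside
   []x - delta, x + delta]], up to the null set [B] where the two suprema differ. *)
have bound (delta : R) : (eps < delta)%R ->
    P [set w | `|process_sup X w - x%:E| <= eps%:E] <= (4 * delta * (a + 1))%:E.
  move=> ed; have [B [mB B0 sB]] := supE.
  pose C := [set w | (x - delta)%:E < seq_sup Y w <= (x + delta)%:E].
  have mC : measurable C.
    rewrite (_ : C = (setT `&` [set w | (x - delta)%:E < seq_sup Y w]) `&`
                     (setT `&` [set w | seq_sup Y w <= (x + delta)%:E])).
      by apply: measurableI; [exact: emeasurable_fun_o_infty|exact: emeasurable_fun_infty_c].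
    by rewrite !setTI; apply/seteqP; split => w /= /andP.
  apply: (@le_trans _ _ (P (C `|` B))).
    apply: le_measure; rewrite ?inE.
    + rewrite -[X in measurable X]setTI; apply: emeasurable_fun_infty_c => //.
      by apply: measurableT_comp => //; exact: emeasurable_funB.
    + exact: measurableU.
    move=> w /= H; have [Bw|Bw] := pselect (B w); [by right|left].
    have SE : process_sup X w = seq_sup Y w by apply: contrapT => /sB.
    move: H; rewrite /C /= -SE; case: (process_sup X w) => [r| |]//.
    by rewrite -EFinB abse_EFin !lee_fin !lte_fin ler_norml; lra.
  rewrite measureU0//.
  have uv : (x - delta <= x + delta)%R by lra.
  apply: (le_trans (seq_sup_bound gY mY EY VY uv)).
  apply: (@le_trans _ _ ((2 * (x + delta - (x - delta)))%:E * (a%:E + 1))).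
    apply: lee_wpmul2l; first by rewrite lee_fin; lra.
    by rewrite -aE aXE; exact: integral_seq_sup_pos.
  by rewrite -EFinD -EFinM lee_fin; lra.
rewrite aE -EFinD -EFinM; apply/lee_addgt0Pr => e e0.
have a1 : (0 < 4 * (a + 1))%R by lra.
(* The excess of [delta] over [eps] is tuned so that the bound grows by exactly [e]. *)
apply: (le_trans (bound (eps + e / (4 * (a + 1)))%R _)); first by rewrite ltrDl divr_gt0.
rewrite -EFinD lee_fin.
have -> : (4 * (eps + e / (4 * (a + 1))) * (a + 1) = 4 * eps * (a + 1) + e)%R.
  by field; rewrite lt0r_neq0//; lra.
by [].
Qed.
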